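(* Let $p>0$ be real, let $\sigma(t)=\frac{p+t}{p-t}$, and for each integer $n\ge 1$ let $\lambda_n$ be the root of $\tan(\pi x)=-x/p$ lying in $(n-\tfrac12,n)$. Let $f(z)$ be analytic for $\operatorname{Re}(z)\ge 0$, and write $z=x+iy$. Suppose that $$\int_0^\infty |f(x+iy)|\,dx<\infty \quad (y\in\mathbb{R}),$$ and that this integral is bounded as $|y|\to\infty$. Assume that $$\lim_{y\to\infty}|f(x\pm iy)|e^{-2\pi y}=0$$ uniformly in $x$ on every finite interval (in $x\ge 0$), that $$\lim_{r\to\infty}\int_{-\infty}^{\infty}e^{-2\pi|y|}|f(r+iy)|\,dy=0,$$ and that $\sum_{n=1}^\infty f(\lambda_n)$ converges. Then $$\sum_{n=1}^{\infty}f(\lambda_n)=-\frac12 f(0)+\int_0^{\infty}\frac{p\left(p+\frac1\pi\right)+x^2}{p^2+x^2}f(x)\,dx-\frac{1}{2\pi}\int_0^{\infty}\{f'(it)+f'(-it)\}\log\left(\frac{1}{1-\sigma(-t)e^{-2\pi t}}\right)dt.$$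
   Context: Here $\sigma(-t)=\frac{p-t}{p+t}$, so $1-\sigma(-t)e^{-2\pi t}>0$ for $t>0$, and $\log$ is the real logarithm. The numbers $0,\lambda_1,\lambda_2,\dots$ are exactly the non-negative real solutions $z$ of $\frac{p+iz}{p-iz}e^{2\pi i z}=1$; there is exactly one $\lambda_n$ in each interval $(n-\tfrac12,n)$, $n\ge1$. Integrals over $[0,\infty)$ in the conclusion are understood as improper integrals. *)

(* Defs.v *)
From Stdlib Require Import Reals.
From Coquelicot Require Import Coquelicot.

Open Scope R_scope.

(* [f] is total, but only its values near [z0] matter. *)
Definition analytic_at (f : C -> C) (z0 : C) : Prop :=
  exists (a : nat -> C) (r : posreal),
    forall z : C, Cmod (z - z0)%C < r ->
      @is_pseries C_AbsRing C_NormedModule a (z - z0)%C (f z).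

(* As for any function analytic on a closed set, this provides analyticity on
   an open neighbourhood of the half-plane; [f] is arbitrary elsewhere. *)
Definition analytic_on_right_half_plane (f : C -> C) : Prop :=
  forall z : C, 0 <= Re z -> analytic_at f z.

(* Only [sigma_ratio p (- t)] with [0 < t] is used, where the denominator [p + t] is
   positive. *)
Definition sigma_ratio (p t : R) : R := (p + t) / (p - t).

(* Main.v *)
Require Import Defs.
From Stdlib Require Import Reals Lra Lia ClassicalEpsilon FunctionalExtensionality.
From Coquelicot Require Import Coquelicot.

Open Scope R_scope.

(** Write [g(z) = sigma(i z) exp(2 pi i z)], so that the numbers [lambda_n] and
[0] are the real solutions [z >= 0] of [g(z) = 1].  In the upper half-plane
[|g| < 1], hence [log(1 - g)] is holomorphic there.  The formula comes from
integrating [f'(z) log(1 - g(z))] around the rectangle [[0,N] x [e,Y]] and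
subtracting the conjugate of the same identity for the reflected function
[conj(f(conj z))], which is the contribution of the lower half-plane.

On the imaginary axis [g(it) = sigma(-t) exp(-2 pi t)] is real, and the two left
sides combine to the integral of [(f'(it) + f'(-it)) log(1 - g(it))]: this is
already the last term of the formula.  On the right and on the top side [f'] is
integrated by parts, since the hypotheses control [f] only; there
[|(log(1 - g))'|] is at most a constant times [exp(-2 pi y)].  On the right side
the constant does not depend on [N], because on [Re z = N >= p] the real part of
[g] is negative or zero, so that [|1 - g| >= 1].  Hence the top contributes [0]
as [Y] tends to infinity and the right side contributes at most a constant times the
edge integral of the hypotheses, which tends to [0] as [N] grows
(lemmas [upper_identity], [upper_bound], [contour_bound]).

On the bottom side let [e] tend to [0].  The upper and the lower integrand differ
by [2 i f'(x) Im log(1 - g(x + i e))] up to an error of order [e |log e|].  The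
argument is bounded and converges to a sawtooth: between consecutive zeros it is
[pi x + atan(x / p) - pi n - pi / 2], with slope [pi] times the weight of the
formula, and it jumps from [pi / 2] to [- pi / 2] at each [lambda_n].  Integrating
[f'] against the sawtooth by parts gives [pi] times the sum of the [f(lambda_n)],
half of that multiple of [f(0)], and minus the same multiple of the weighted integral
of [f], apart from a term at [N] that the corners of the contour cancel
(lemma [bottom_limit]).

Letting [N] grow shows that the left-side integrals form a Cauchy family in
[(e, Y)] and that the partial sums converge to the asserted value. *)

(** * Green's formula on a rectangle *)

(** The tube lemma: neighbourhoods of the points of a compact segment contain a
common strip. *)
Lemma locally_2d_tube (P : R -> R -> Prop) (a b y : R) :
  (forall x, a <= x <= b -> locally_2d P x y) ->
  locally y (fun v => forall x, a <= x <= b -> P x v).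
Proof.
  intros H.
  assert (Hc : forall x, exists d : posreal, a <= x <= b ->
    forall u v, Rabs (u - x) < d -> Rabs (v - y) < d -> P u v).
  { intros x.
    destruct (Rle_dec a x) as [h1|h1]; [destruct (Rle_dec x b) as [h2|h2]|].
    - destruct (H x (conj h1 h2)) as [d Hd]. exists d. auto.
    - exists (mkposreal 1 Rlt_0_1). tauto.
    - exists (mkposreal 1 Rlt_0_1). tauto. }
  pose (delta := fun x => proj1_sig (constructive_indefinite_description _ (Hc x))).
  assert (Hd : forall x, a <= x <= b ->
    forall u v, Rabs (u - x) < delta x -> Rabs (v - y) < delta x -> P u v).
  { intros x. unfold delta.
    destruct (constructive_indefinite_description _ (Hc x)) as [d h]. exact h. }
  destruct (compactness_value_1d a b delta) as [d Hd'].
  exists d. intros v Hv x Hx.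
  (* The compactness lemma yields its conclusion up to double negation. *)
  apply NNPP. intros Hn. apply (Hd' x Hx). intros [t [Ht [Hxt Hdt]]].
  apply Hn. apply (Hd t Ht); [exact Hxt|].
  apply Rlt_le_trans with d; [exact Hv | exact Hdt].
Qed.

Lemma continuity_2d_pt_swap (f : R -> R -> R) x y :
  continuity_2d_pt f x y -> continuity_2d_pt (fun u v => f v u) y x.
Proof.
  intros H eps. destruct (H eps) as [d Hd]. exists d. auto.
Qed.

Lemma continuity_2d_pt_continuous_fst (f : R -> R -> R) x y :
  continuity_2d_pt f x y -> continuous (fun t => f t y) x.
Proof.
  intros H. apply continuity_pt_filterlim.
  apply continuity_pt_locally. intros eps. destruct (H eps) as [d Hd].
  exists d. intros t Ht. apply Hd; [exact Ht|].
  rewrite Rminus_diag, Rabs_R0. apply cond_pos.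
Qed.

Lemma continuity_2d_pt_continuous_snd (f : R -> R -> R) x y :
  continuity_2d_pt f x y -> continuous (fun t => f x t) y.
Proof.
  intros H. apply (continuity_2d_pt_continuous_fst (fun u v => f v u)).
  now apply continuity_2d_pt_swap.
Qed.

(** The integral of [u] over a horizontal segment has [y]-derivative
    [int_a^b q = w b y - w a y]. *)
Lemma green_rectangle (u w q : R -> R -> R) (a b c e : R) :
  a <= b -> c <= e ->
  (forall x y, a <= x <= b -> c <= y <= e ->
     locally_2d (fun x y => is_derive (fun t => u x t) y (q x y) /\
                            is_derive (fun t => w t y) x (q x y) /\
                            continuous (fun t => u t y) x) x y /\
     continuity_2d_pt u x y /\ continuity_2d_pt w x y /\
     continuity_2d_pt q x y) ->
  is_RInt (fun y => w b y - w a y) c e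
    (RInt (fun x => u x e) a b - RInt (fun x => u x c) a b).
Proof.
  intros Hab Hce H.
  assert (Hcu : forall y, c <= y <= e -> ex_RInt (fun x => u x y) a b).
  { intros y Hy. apply (@ex_RInt_continuous R_CompleteNormedModule).
    rewrite Rmin_left, Rmax_right by lra. intros x Hx.
    apply (continuity_2d_pt_continuous_fst u). now apply H. }
  assert (Hcw : forall x y, a <= x <= b -> c <= y <= e ->
                  continuous (fun t => w x t) y).
  { intros x y Hx Hy. apply (continuity_2d_pt_continuous_snd w). now apply H. }
  apply (is_RInt_derive (fun y => RInt (fun x => u x y) a b));
    rewrite Rmin_left, Rmax_right by lra; intros y Hy.
  2:{ apply (@continuous_minus R_UniformSpace R_AbsRing R_NormedModule);
        apply Hcw; lra. }
  assert (Ht : locally y (fun v => forall x, a <= x <= b ->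
     is_derive (fun t => u x t) v (q x v) /\
     is_derive (fun t => w t v) x (q x v) /\
     continuous (fun t => u t v) x)).
  { apply (locally_2d_tube (fun x v => is_derive (fun t => u x t) v (q x v) /\
     is_derive (fun t => w t v) x (q x v) /\
     continuous (fun t => u t v) x)). intros x Hx. now apply H. }
  assert (Hi : is_RInt (fun x => q x y) a b (w b y - w a y)).
  { apply (is_RInt_derive (fun x => w x y));
    rewrite Rmin_left, Rmax_right by lra; intros x Hx.
    - destruct (H x y Hx Hy) as [H1 _]. apply locally_2d_singleton in H1. tauto.
    - apply (continuity_2d_pt_continuous_fst q). now apply H. }
  replace (w b y - w a y) with
    (RInt (fun x => Derive (fun v => u x v) y) a b).
  - apply (is_derive_RInt_param (fun y x => u x y) a b y).
    + rewrite Rmin_left, Rmax_right by lra.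
      refine (filter_imp _ _ _ Ht). intros v Hv x Hx. specialize (Hv x Hx).
      exists (q x v). tauto.
    + rewrite Rmin_left, Rmax_right by lra. intros x Hx.
      apply continuity_2d_pt_swap with (f := fun x v => Derive (fun z => u x z) v).
      destruct (H x y Hx Hy) as [H1 [_ [_ H2]]].
      refine (continuity_2d_pt_ext_loc _ _ _ _ _ H2).
      refine (locally_2d_impl _ _ _ _ _ H1). apply locally_2d_forall.
      intros x' v [H3 _]. symmetry. now apply is_derive_unique.
    + refine (filter_imp _ _ _ Ht). intros v Hv.
      apply (@ex_RInt_continuous R_CompleteNormedModule).
      rewrite Rmin_left, Rmax_right by lra. intros x Hx.
      now apply Hv.
  - apply is_RInt_unique. refine (is_RInt_ext _ _ _ _ _ _ Hi).
    rewrite Rmin_left, Rmax_right by lra. intros x Hx.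
    symmetry. apply is_derive_unique.
    destruct (H x y) as [H1 _]; [lra..|]. apply locally_2d_singleton in H1. tauto.
Qed.

(** * Complex-valued functions of a real variable *)

(** Componentwise, so that the calculus of real functions applies directly. *)
Definition cder (phi : R -> C) (t : R) (d : C) : Prop :=
  is_derive (fun t => fst (phi t)) t (fst d) /\
  is_derive (fun t => snd (phi t)) t (snd d).

Notation CInt := (@RInt C_R_CompleteNormedModule).
Notation is_CInt := (@is_RInt C_R_NormedModule).

Lemma cder_eq phi t d d' : cder phi t d -> d = d' -> cder phi t d'.
Proof. now intros H <-. Qed.

Lemma cder_const c t : cder (fun _ => c) t 0%C.
Proof. split; exact (is_derive_const (V := R_NormedModule) _ t). Qed.

Lemma cder_RtoC f t d : is_derive f t d -> cder (fun t => RtoC (f t)) t (RtoC d).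
Proof. intros H; split; [exact H | exact (is_derive_const (V := R_NormedModule) _ t)]. Qed.

Lemma cder_plus f g t df dg :
  cder f t df -> cder g t dg -> cder (fun t => f t + g t)%C t (df + dg)%C.
Proof.
  intros [H1 H2] [H3 H4]; split; simpl.
  - exact (is_derive_plus _ _ _ _ _ H1 H3).
  - exact (is_derive_plus _ _ _ _ _ H2 H4).
Qed.

Lemma cder_opp f t df : cder f t df -> cder (fun t => - f t)%C t (- df)%C.
Proof.
  intros [H1 H2]; split; simpl.
  - exact (is_derive_opp _ _ _ H1).
  - exact (is_derive_opp _ _ _ H2).
Qed.

Lemma cder_minus f g t df dg :
  cder f t df -> cder g t dg -> cder (fun t => f t - g t)%C t (df - dg)%C.
Proof. intros H1 H2. apply cder_plus; [exact H1 | now apply cder_opp]. Qed.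

(** [auto_derive] needs the components as honest real functions. *)
Lemma cder_components (phi : R -> C) :
  exists u v : R -> R, phi = fun t => (u t, v t).
Proof.
  exists (fun t => fst (phi t)), (fun t => snd (phi t)).
  apply functional_extensionality. intros t. apply surjective_pairing.
Qed.

Lemma cder_mult f g t df dg :
  cder f t df -> cder g t dg ->
  cder (fun t => f t * g t)%C t (df * g t + f t * dg)%C.
Proof.
  destruct (cder_components f) as (u & v & ->).
  destruct (cder_components g) as (u' & v' & ->).
  intros [H1 H2] [H3 H4]. simpl in *.
  split; simpl; auto_derive; rewrite
    ?(is_derive_unique _ _ _ H1), ?(is_derive_unique _ _ _ H2),
    ?(is_derive_unique _ _ _ H3), ?(is_derive_unique _ _ _ H4);
  repeat split; try (eexists; eassumption); ring.
Qed.

Lemma C_neq0_sqr (z : C) : z <> 0%C -> 0 < fst z ^ 2 + snd z ^ 2.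
Proof.
  intros H. destruct z as [x y]; simpl.
  destruct (Req_dec x 0) as [->|Hx]; [destruct (Req_dec y 0) as [->|Hy]|].
  - now contradiction H.
  - assert (0 < y * y) by nra. lra.
  - assert (0 < x * x) by nra. nra.
Qed.

Lemma cder_inv f t df :
  cder f t df -> f t <> 0%C -> cder (fun t => / f t)%C t (- df / (f t * f t))%C.
Proof.
  destruct (cder_components f) as (u & v & ->).
  intros [H1 H2] H0. apply C_neq0_sqr in H0. simpl in *.
  assert (0 < (u t * u t - v t * v t) ^ 2 + (u t * v t + v t * u t) ^ 2).
  { replace (_ + _) with ((u t * u t + v t * v t) ^ 2) by ring. nra. }
  split; simpl; auto_derive; rewrite
    ?(is_derive_unique _ _ _ H1), ?(is_derive_unique _ _ _ H2);
  repeat split; try (eexists; eassumption); try lra;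
   field; simpl; nra.
Qed.

(** On the right half-plane this is the principal logarithm. *)
Definition Clog (u : C) : C :=
  (/ 2 * ln (fst u ^ 2 + snd u ^ 2), atan (snd u / fst u)).

Lemma cder_Clog f t df :
  cder f t df -> 0 < fst (f t) -> cder (fun t => Clog (f t)) t (df / f t)%C.
Proof.
  destruct (cder_components f) as (u & v & ->).
  intros [H1 H2] H0. simpl in *.
  assert (Hp : 0 < u t ^ 2 + v t ^ 2) by nra. simpl in Hp.
  split; simpl; auto_derive; rewrite
    ?(is_derive_unique _ _ _ H1), ?(is_derive_unique _ _ _ H2);
  repeat split; try (eexists; eassumption); try lra; simpl.
  all: unfold Rsqr; field; simpl; nra.
Qed.

Definition Cexp (u : C) : C := (exp (fst u) * cos (snd u), exp (fst u) * sin (snd u)).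

Lemma cder_Cexp f t df :
  cder f t df -> cder (fun t => Cexp (f t)) t (df * Cexp (f t))%C.
Proof.
  destruct (cder_components f) as (u & v & ->).
  intros [H1 H2]. simpl in *.
  split; simpl; auto_derive; rewrite
    ?(is_derive_unique _ _ _ H1), ?(is_derive_unique _ _ _ H2);
  repeat split; try (eexists; eassumption); ring.
Qed.

Lemma cder_is_derive f t df : cder f t df -> @is_derive R_AbsRing C_R_NormedModule f t df.
Proof.
  intros [H1 H2].
  apply (@filterdiff_ext_lin R_AbsRing (AbsRing_NormedModule R_AbsRing) C_R_NormedModule _ _ _
    (fun h : R => (h * fst df, h * snd df) : C)).
  - apply (@filterdiff_ext R_AbsRing (AbsRing_NormedModule R_AbsRing) C_R_NormedModule _ _
      (fun t => (fst (f t), snd (f t)) : C)).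
    { intros s. now rewrite <- surjective_pairing. }
    apply (@filterdiff_comp'_2 R_AbsRing (AbsRing_NormedModule R_AbsRing)
      R_NormedModule R_NormedModule C_R_NormedModule
      (fun t => fst (f t)) (fun t => snd (f t))
      (fun x y => (x, y) : C) t (fun h : R => h * fst df) (fun h : R => h * snd df)
      (fun x y => (x, y) : C) H1 H2).
    apply filterdiff_linear. 
    apply (is_linear_ext (fun t : R_NormedModule * R_NormedModule => t)).
    { intros s. apply surjective_pairing. }
    apply is_linear_id.
  - intros h. reflexivity.
Qed.

Lemma norm_C (z : C) : @norm R_AbsRing C_R_NormedModule z = Cmod z.
Proof.
  unfold norm, Cmod; simpl. unfold prod_norm. f_equal. simpl.
  unfold norm; simpl. unfold abs; simpl.
  rewrite !Rmult_1_r, <- !Rabs_mult, !Rabs_pos_eq; [reflexivity|nra..].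
Qed.

Lemma continuous_C (f : R -> C) t :
  continuous (fun t => fst (f t)) t -> continuous (fun t => snd (f t)) t ->
  @continuous R_UniformSpace C_R_NormedModule f t.
Proof.
  intros H1 H2.
  apply (continuous_ext (fun t => (fst (f t), snd (f t)) : C)).
  { intros s. now rewrite <- surjective_pairing. }
  apply (continuous_comp_2 (V := R_UniformSpace) (W := R_UniformSpace)
    (X := C_R_NormedModule) (fun t => fst (f t)) (fun t => snd (f t))
    (fun x y => (x, y)));
    [exact H1 | exact H2 |].
  apply (continuous_ext (fun z => z)).
  { intros s. apply surjective_pairing. }
  apply continuous_id.
Qed.

(** * Complex differentiation along curves *)

(** Differentiability of [h] at [z] with derivative [l] in the form in which it
    is used: the chain rule along every differentiable curve through [z]. *)
Definition cdiff (h : C -> C) (z l : C) : Prop :=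
  forall (zeta : R -> C) (t : R) (d : C),
    zeta t = z -> cder zeta t d -> cder (fun t => h (zeta t)) t (l * d)%C.

Definition cont2 (h : C -> C) (z : C) : Prop :=
  continuity_2d_pt (fun x y => fst (h (x, y))) (fst z) (snd z) /\
  continuity_2d_pt (fun x y => snd (h (x, y))) (fst z) (snd z).

(** Differentiability is asked for in a neighbourhood and continuity of the
    derivative at the point only: this is what differentiation under the integral
    sign uses. *)
Definition holo (h d : C -> C) (z : C) : Prop :=
  locally_2d (fun x y => cdiff h (x, y) (d (x, y))) (fst z) (snd z) /\
  cont2 h z /\ cont2 d z.

Lemma cdiff_eq h z l l' : cdiff h z l -> l = l' -> cdiff h z l'.
Proof. now intros H <-. Qed.

Lemma cdiff_const c z : cdiff (fun _ => c) z 0%C.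
Proof.
  intros zeta t d _ _. eapply cder_eq; [apply cder_const | ring].
Qed.

Lemma cdiff_id z : cdiff (fun z => z) z 1%C.
Proof. intros zeta t d _ H. eapply cder_eq; [exact H | ring]. Qed.

Lemma cdiff_plus f g z l m :
  cdiff f z l -> cdiff g z m -> cdiff (fun z => f z + g z)%C z (l + m)%C.
Proof.
  intros Hf Hg zeta t d E H.
  eapply cder_eq; [apply cder_plus; [exact (Hf zeta t d E H) | exact (Hg zeta t d E H)] | ring].
Qed.

Lemma cdiff_minus f g z l m :
  cdiff f z l -> cdiff g z m -> cdiff (fun z => f z - g z)%C z (l - m)%C.
Proof.
  intros Hf Hg zeta t d E H.
  eapply cder_eq; [apply cder_minus; [exact (Hf zeta t d E H) | exact (Hg zeta t d E H)] | ring].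
Qed.

Lemma cdiff_mult f g z l m :
  cdiff f z l -> cdiff g z m ->
  cdiff (fun z => f z * g z)%C z (l * g z + f z * m)%C.
Proof.
  intros Hf Hg zeta t d E H.
  eapply cder_eq; [apply cder_mult; [exact (Hf zeta t d E H) | exact (Hg zeta t d E H)] |].
  cbv beta; rewrite E; ring.
Qed.

Lemma cdiff_inv f z l :
  cdiff f z l -> f z <> 0%C -> cdiff (fun z => / f z)%C z (- l / (f z * f z))%C.
Proof.
  intros Hf H0 zeta t d E H.
  eapply cder_eq; [apply cder_inv; [exact (Hf zeta t d E H) | now rewrite E] |].
  cbv beta; rewrite E; field; exact H0.
Qed.

Lemma cdiff_Cexp f z l : cdiff f z l -> cdiff (fun z => Cexp (f z)) z (l * Cexp (f z))%C.
Proof.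
  intros Hf zeta t d E H.
  eapply cder_eq; [apply cder_Cexp; exact (Hf zeta t d E H) |].
  cbv beta; rewrite E; ring.
Qed.

Lemma cdiff_Clog f z l :
  cdiff f z l -> 0 < fst (f z) -> cdiff (fun z => Clog (f z)) z (l / f z)%C.
Proof.
  intros Hf H0 zeta t d E H.
  assert (f z <> 0%C). { intros Hz. rewrite Hz in H0. simpl in H0. lra. }
  eapply cder_eq; [apply cder_Clog; [exact (Hf zeta t d E H) | now rewrite E] |].
  cbv beta; rewrite E; field; assumption.
Qed.

Lemma cder_horizontal x y : cder (fun t => (t, y) : C) x 1%C.
Proof. split; [exact (is_derive_id (K := R_AbsRing) x) | exact (is_derive_const (V := R_NormedModule) _ x)]. Qed.

Lemma cder_vertical x y : cder (fun t => (x, t) : C) y Ci.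
Proof. split; [exact (is_derive_const (V := R_NormedModule) _ y) | exact (is_derive_id (K := R_AbsRing) y)]. Qed.

Lemma cdiff_horizontal h x y l :
  cdiff h (x, y) l -> cder (fun t => h (t, y)) x l.
Proof.
  intros H. eapply cder_eq; [apply (H (fun t => (t, y)) x 1%C eq_refl), cder_horizontal | ring].
Qed.

Lemma cdiff_vertical h x y l :
  cdiff h (x, y) l -> cder (fun t => h (x, t)) y (Ci * l)%C.
Proof.
  intros H. eapply cder_eq; [apply (H (fun t => (x, t)) y Ci eq_refl), cder_vertical | ring].
Qed.

Lemma cont2_const c z : cont2 (fun _ => c) z.
Proof. split; apply continuity_2d_pt_const. Qed.

Lemma cont2_id z : cont2 (fun z => z) z.
Proof. split; [apply continuity_2d_pt_id1 | apply continuity_2d_pt_id2]. Qed.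

Lemma cont2_plus f g z : cont2 f z -> cont2 g z -> cont2 (fun z => f z + g z)%C z.
Proof.
  intros [H1 H2] [H3 H4]; split; simpl; now apply continuity_2d_pt_plus.
Qed.

Lemma cont2_opp f z : cont2 f z -> cont2 (fun z => - f z)%C z.
Proof.
  intros [H1 H2]; split; simpl; now apply continuity_2d_pt_opp.
Qed.

Lemma cont2_minus f g z : cont2 f z -> cont2 g z -> cont2 (fun z => f z - g z)%C z.
Proof. intros H1 H2. apply cont2_plus; [exact H1 | now apply cont2_opp]. Qed.

Lemma cont2_mult f g z : cont2 f z -> cont2 g z -> cont2 (fun z => f z * g z)%C z.
Proof.
  intros [H1 H2] [H3 H4]; split; simpl.
  - apply continuity_2d_pt_minus; now apply continuity_2d_pt_mult.
  - apply continuity_2d_pt_plus; now apply continuity_2d_pt_mult.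
Qed.

Lemma cont2_inv f z : cont2 f z -> f z <> 0%C -> cont2 (fun z => / f z)%C z.
Proof.
  destruct z as [x y]. intros [H1 H2] H0. apply C_neq0_sqr in H0. simpl fst in *; simpl snd in *.
  assert (Hd : continuity_2d_pt (fun x y => / (fst (f (x, y)) ^ 2 + snd (f (x, y)) ^ 2))
                 x y).
  { apply continuity_2d_pt_inv.
    - apply continuity_2d_pt_plus; simpl; repeat apply continuity_2d_pt_mult;
        try assumption; apply continuity_2d_pt_const.
    - lra. }
  split; unfold Rdiv; simpl; apply continuity_2d_pt_mult; try exact Hd; try assumption.
  now apply continuity_2d_pt_opp.
Qed.

Lemma cont2_Cexp f z : cont2 f z -> cont2 (fun z => Cexp (f z)) z.
Proof.
  intros [H1 H2]; split; simpl; apply continuity_2d_pt_mult;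
    apply continuity_1d_2d_pt_comp; try assumption.
  - apply derivable_continuous_pt, derivable_pt_exp.
  - apply continuity_cos.
  - apply derivable_continuous_pt, derivable_pt_exp.
  - apply continuity_sin.
Qed.

Lemma cont2_Clog f z : cont2 f z -> 0 < fst (f z) -> cont2 (fun z => Clog (f z)) z.
Proof.
  destruct z as [x y]. intros [H1 H2] H0; split; simpl in *.
  - apply continuity_2d_pt_mult; [apply continuity_2d_pt_const |].
    apply (continuity_1d_2d_pt_comp ln).
    + apply derivable_continuous_pt. eexists. apply derivable_pt_lim_ln.
      nra.
    + apply continuity_2d_pt_plus; repeat apply continuity_2d_pt_mult;
        try assumption; apply continuity_2d_pt_const.
  - apply (continuity_1d_2d_pt_comp atan).
    + apply derivable_continuous_pt, derivable_pt_atan.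
    + apply continuity_2d_pt_mult; [assumption |].
      apply continuity_2d_pt_inv; [assumption |].
      lra.
Qed.

Lemma cont2_horizontal h x y :
  cont2 h (x, y) -> @continuous R_UniformSpace C_R_NormedModule (fun t => h (t, y)) x.
Proof.
  intros [H1 H2]. apply continuous_C.
  - exact (continuity_2d_pt_continuous_fst _ _ _ H1).
  - exact (continuity_2d_pt_continuous_fst _ _ _ H2).
Qed.

Lemma cont2_vertical h x y :
  cont2 h (x, y) -> @continuous R_UniformSpace C_R_NormedModule (fun t => h (x, t)) y.
Proof.
  intros [H1 H2]. apply continuous_C.
  - exact (continuity_2d_pt_continuous_snd _ _ _ H1).
  - exact (continuity_2d_pt_continuous_snd _ _ _ H2).
Qed.

Lemma holo_cdiff h d z : holo h d z -> cdiff h z (d z).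
Proof.
  intros [H _]. apply locally_2d_singleton in H.
  now rewrite <- surjective_pairing in H.
Qed.

Lemma holo_mult f f' g g' z :
  holo f f' z -> holo g g' z ->
  holo (fun z => f z * g z)%C (fun z => f' z * g z + f z * g' z)%C z.
Proof.
  intros (H1 & H2 & H3) (H4 & H5 & H6). split; [|split].
  - refine (locally_2d_impl _ _ _ _ _ H1). refine (locally_2d_impl _ _ _ _ _ H4).
    apply locally_2d_forall. intros x y Hg Hf. now apply cdiff_mult.
  - now apply cont2_mult.
  - apply cont2_plus; now apply cont2_mult.
Qed.

Lemma is_CInt_components (f : R -> C) a b l :
  is_CInt f a b l <->
  is_RInt (fun t => fst (f t)) a b (fst l) /\ is_RInt (fun t => snd (f t)) a b (snd l).
Proof.
  split.
  - intros H. split.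
    + exact (is_RInt_fct_extend_fst (U := R_NormedModule) (V := R_NormedModule) f a b l H).
    + exact (is_RInt_fct_extend_snd (U := R_NormedModule) (V := R_NormedModule) f a b l H).
  - intros [H1 H2]. destruct l as [l1 l2].
    exact (is_RInt_fct_extend_pair (U := R_NormedModule) (V := R_NormedModule) f a b l1 l2 H1 H2).
Qed.

Lemma ex_CInt_cont (f : R -> C) a b :
  a <= b ->
  (forall t, a <= t <= b -> @continuous R_UniformSpace C_R_NormedModule f t) ->
  is_CInt f a b (CInt f a b).
Proof.
  intros Hab H. apply (@RInt_correct C_R_CompleteNormedModule).
  apply (@ex_RInt_continuous C_R_CompleteNormedModule).
  rewrite Rmin_left, Rmax_right by lra. exact H.
Qed.

Lemma cder_is_CInt (f d : R -> C) a b :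
  a <= b -> (forall t, a <= t <= b -> cder f t (d t)) ->
  (forall t, a <= t <= b -> @continuous R_UniformSpace C_R_NormedModule d t) ->
  is_CInt d a b (f b - f a)%C.
Proof.
  intros Hab H1 H2.
  apply (@is_RInt_derive C_R_CompleteNormedModule f d a b);
    rewrite Rmin_left, Rmax_right by lra; intros t Ht.
  - apply cder_is_derive. now apply H1.
  - now apply H2.
Qed.

Lemma is_CInt_mult (k : C) (f : R -> C) a b (l : C) :
  is_CInt f a b l -> is_CInt (fun t => k * f t)%C a b (k * l)%C.
Proof.
  intros H. apply is_CInt_components in H. destruct H as [H1 H2].
  apply is_CInt_components; split; simpl.
  - exact (is_RInt_minus _ _ _ _ _ _
      (is_RInt_scal (V := R_NormedModule) _ _ _ (fst k) _ H1)
      (is_RInt_scal (V := R_NormedModule) _ _ _ (snd k) _ H2)).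
  - exact (is_RInt_plus _ _ _ _ _ _
      (is_RInt_scal (V := R_NormedModule) _ _ _ (fst k) _ H2)
      (is_RInt_scal (V := R_NormedModule) _ _ _ (snd k) _ H1)).
Qed.

(** Cauchy's theorem: the real and the imaginary part of [h dz] are closed
    forms by the Cauchy-Riemann equations. *)
Theorem cauchy_rectangle (h d : C -> C) (a b c e : R) (B T Le Ri : C) :
  a <= b -> c <= e ->
  (forall x y, a <= x <= b -> c <= y <= e -> holo h d (x, y)) ->
  is_CInt (fun x => h (x, c)) a b B -> is_CInt (fun x => h (x, e)) a b T ->
  is_CInt (fun y => h (a, y)) c e Le -> is_CInt (fun y => h (b, y)) c e Ri ->
  (B + Ci * Ri - T - Ci * Le = 0)%C.
Proof.
  intros Hab Hce H HB HT HL HR.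
  apply is_CInt_components in HB, HT, HL, HR.
  destruct HB as [B1 B2], HT as [T1 T2], HL as [L1 L2], HR as [R1 R2].
  assert (G1 := green_rectangle (fun x y => fst (h (x, y))) (fun x y => - snd (h (x, y)))
     (fun x y => - snd (d (x, y))) a b c e Hab Hce).
  assert (G2 := green_rectangle (fun x y => snd (h (x, y))) (fun x y => fst (h (x, y)))
     (fun x y => fst (d (x, y))) a b c e Hab Hce).
  cbv beta in G1, G2.
  rewrite (is_RInt_unique _ _ _ _ T1), (is_RInt_unique _ _ _ _ B1) in G1.
  rewrite (is_RInt_unique _ _ _ _ T2), (is_RInt_unique _ _ _ _ B2) in G2.
  assert (E1 : is_RInt (fun y => - snd (h (b, y)) - - snd (h (a, y))) c e
                 (- snd Ri - - snd Le)).
  { apply (is_RInt_minus (V := R_NormedModule)); now apply (is_RInt_opp (V := R_NormedModule)). }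
  assert (E2 : is_RInt (fun y => fst (h (b, y)) - fst (h (a, y))) c e
                 (fst Ri - fst Le)).
  { now apply (is_RInt_minus (V := R_NormedModule)). }
  apply (is_RInt_unique (V := R_CompleteNormedModule)) in E1, E2.
  assert (Q1 : fst T - fst B = - snd Ri - - snd Le).
  { rewrite <- E1. symmetry. apply is_RInt_unique, G1.
    intros x y Hx Hy. destruct (H x y Hx Hy) as (K1 & [K2 K2'] & [K3 K3']). simpl in *.
    refine (conj _ (conj _ (conj _ _))); try assumption; try now apply continuity_2d_pt_opp.
    refine (locally_2d_impl _ _ _ _ _ K1). apply locally_2d_forall. intros u v K.
    destruct (cdiff_horizontal _ _ _ _ K) as [P1 P2].
    destruct (cdiff_vertical _ _ _ _ K) as [P3 P4]. simpl in *.
    refine (conj _ (conj _ _)).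
    - replace (- snd (d (u, v))) with (0 * fst (d (u, v)) - 1 * snd (d (u, v))) by ring.
      exact P3.
    - exact (is_derive_opp _ _ _ P2).
    - apply (ex_derive_continuous (V := R_NormedModule)). now exists (fst (d (u, v))). }
  assert (Q2 : snd T - snd B = fst Ri - fst Le).
  { rewrite <- E2. symmetry. apply is_RInt_unique, G2.
    intros x y Hx Hy. destruct (H x y Hx Hy) as (K1 & [K2 K2'] & [K3 K3']). simpl in *.
    refine (conj _ (conj _ (conj _ _))); try assumption.
    refine (locally_2d_impl _ _ _ _ _ K1). apply locally_2d_forall. intros u v K.
    destruct (cdiff_horizontal _ _ _ _ K) as [P1 P2].
    destruct (cdiff_vertical _ _ _ _ K) as [P3 P4]. simpl in *.
    refine (conj _ (conj _ _)).
    - replace (fst (d (u, v))) with (0 * snd (d (u, v)) + 1 * fst (d (u, v))) by ring.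
      exact P4.
    - exact P1.
    - apply (ex_derive_continuous (V := R_NormedModule)). now exists (snd (d (u, v))). }
  apply injective_projections; simpl; lra.
Qed.

(** * Complex power series *)

Notation is_Cseries := (@is_series C_AbsRing C_NormedModule).
Notation is_Cpseries := (@is_pseries C_AbsRing C_NormedModule).

Lemma is_Cpseries_iff a u l :
  is_Cpseries a u l <-> is_Cseries (fun n => a n * u ^ n)%C l.
Proof.
  assert (E : forall n, scal (@pow_n C_AbsRing u n) (a n : C_NormedModule) = (a n * u ^ n)%C).
  { assert (Hp : forall n, @pow_n C_AbsRing u n = (u ^ n)%C).
    { induction n as [|n IH]; [reflexivity|]. rewrite Cpow_S, <- IH. reflexivity. }
    intros n. rewrite Hp. apply Cmult_comm. }
  split; intros H.
  - exact (is_series_ext _ _ _ E H).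
  - exact (is_series_ext _ _ _ (fun n => eq_sym (E n)) H).
Qed.

Lemma is_Cseries_Cmod_le (a : nat -> C) (b : nat -> R) l m :
  is_Cseries a l -> is_series b m -> (forall n, Cmod (a n) <= b n) -> Cmod l <= m.
Proof.
  intros Ha Hb Hab.
  refine (filterlim_le (F := eventually) (fun n => Cmod (sum_n a n)) (sum_n b) (Cmod l) m _ _ Hb).
  - exists 0%nat. intros n _. induction n as [|n IH].
    + rewrite !sum_O. apply Hab.
    + rewrite !sum_Sn. change (Cmod (sum_n a n + a (S n)) <= sum_n b n + b (S n)).
      eapply Rle_trans; [apply Cmod_triangle|]. specialize (Hab (S n)). lra.
  - exact (filterlim_comp _ _ _ _ _ _ _ _ Ha (@filterlim_norm C_AbsRing C_NormedModule l)).
Qed.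

Section PowerSeries.

Variables (a : nat -> C) (r : R) (f : C -> C).
Hypothesis Hf : forall u, Cmod u < r -> is_Cpseries a u (f u).

(** The terms of a series that converges at [s > rho] are bounded, which bounds the
radius of convergence of the series of moduli from below.  All estimates below are
thus reduced to real power series. *)
Lemma CV_radius_Cmod (rho : R) :
  0 <= rho < r -> Rbar_lt rho (CV_radius (fun n => Cmod (a n))).
Proof.
  intros Hrho. set (s := (rho + r) / 2).
  assert (Hs : rho < s < r) by (unfold s; lra).
  apply Rbar_lt_le_trans with s; [exact (proj1 Hs)|].
  apply CV_radius_bounded.
  assert (Hsum : is_Cseries (fun n => a n * RtoC s ^ n)%C (f (RtoC s))).
  { apply (proj1 (is_Cpseries_iff a (RtoC s) _)), Hf. rewrite Cmod_R, Rabs_pos_eq; lra. }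
  destruct (@filterlim_bounded C_AbsRing C_NormedModule _ (ex_intro _ _ Hsum)) as [M HM].
  exists (2 * M). intros n.
  rewrite Rabs_pos_eq.
  2: { apply Rmult_le_pos; [apply Cmod_ge_0 | apply pow_le; lra]. }
  replace (Cmod (a n) * s ^ n) with (Cmod (a n * RtoC s ^ n)).
  2: { rewrite Cmod_mult, Cmod_pow, Cmod_R, Rabs_pos_eq; [reflexivity | lra]. }
  pose proof (HM 0%nat) as H0.
  change (norm (sum_n (fun n => a n * RtoC s ^ n)%C 0)) with
    (Cmod (sum_n (fun n => a n * RtoC s ^ n)%C 0)) in H0.
  destruct n as [|n].
  - rewrite sum_O in H0. pose proof (Cmod_ge_0 (a 0%nat * RtoC s ^ 0)). lra.
  - pose proof (HM n) as H1. pose proof (HM (S n)) as H2.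
    rewrite sum_Sn in H2.
    change (Cmod (sum_n (fun n => a n * RtoC s ^ n)%C n) <= M) in H1.
    change (Cmod (sum_n (fun n => a n * RtoC s ^ n)%C n + a (S n) * RtoC s ^ (S n))%C <= M) in H2.
    set (S1 := sum_n (fun n => a n * RtoC s ^ n)%C n) in *.
    set (t := (a (S n) * RtoC s ^ (S n))%C) in *.
    replace t with ((S1 + t) + - S1)%C by ring.
    eapply Rle_trans; [apply Cmod_triangle|]. rewrite Cmod_opp. lra.
Qed.

Definition deriv_coef (n : nat) : C := (RtoC (INR (S n)) * a (S n))%C.

Lemma Cmod_deriv_coef n : Cmod (deriv_coef n) = PS_derive (fun n => Cmod (a n)) n.
Proof.
  unfold deriv_coef, PS_derive. rewrite Cmod_mult, Cmod_R, Rabs_pos_eq; [reflexivity|].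
  apply pos_INR.
Qed.

Lemma deriv_series_converges u : Cmod u < r -> exists l, is_Cpseries deriv_coef u l.
Proof.
  intros Hu.
  assert (Hr : Rbar_lt (Rabs (Cmod u)) (CV_radius (PS_derive (fun n => Cmod (a n))))).
  { rewrite CV_radius_derive, Rabs_pos_eq by apply Cmod_ge_0.
    apply CV_radius_Cmod. split; [apply Cmod_ge_0 | exact Hu]. }
  apply CV_disk_inside in Hr.
  destruct (@ex_series_le C_AbsRing C_CompleteNormedModule
    (fun n => deriv_coef n * u ^ n)%C
    (fun n => Rabs (PS_derive (fun n => Cmod (a n)) n * Cmod u ^ n))) with (2 := Hr) as [l Hl].
  { intros n. change (Cmod (deriv_coef n * u ^ n) <= Rabs (PS_derive (fun n => Cmod (a n)) n * Cmod u ^ n)).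
    rewrite Cmod_mult, Cmod_pow, Cmod_deriv_coef. apply Rle_abs. }
  exists l. exact (proj2 (is_Cpseries_iff _ _ _) Hl).
Qed.

(** The Taylor remainder of [z ^ (n + 2)]; the induction rests on
    [E (n + 1) = w * E n + n * z ^ (n - 1) * (w - z) ^ 2]. *)
Lemma Cpow_remainder (rho : R) (z w : C) (n : nat) :
  Cmod z <= rho -> Cmod w <= rho ->
  Cmod (w ^ S (S n) - z ^ S (S n) - RtoC (INR (S (S n))) * z ^ S n * (w - z))
    <= INR (S n) * INR (S (S n)) * rho ^ n * Cmod (w - z) ^ 2.
Proof.
  intros Hz Hw.
  assert (H0 : 0 <= Cmod z) by apply Cmod_ge_0.
  induction n as [|n IH].
  - replace (w ^ 2 - z ^ 2 - RtoC (INR 2) * z ^ 1 * (w - z))%C with ((w - z) ^ 2)%C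
      by (simpl INR; rewrite RtoC_plus; ring).
    rewrite Cmod_pow. simpl. pose proof (pow2_ge_0 (Cmod (w - z))). simpl in *. lra.
  - set (k := S n) in *.
    replace (w ^ S (S k) - z ^ S (S k) - RtoC (INR (S (S k))) * z ^ S k * (w - z))%C
      with (w * (w ^ S k - z ^ S k - RtoC (INR (S k)) * z ^ k * (w - z))
            + RtoC (INR (S k)) * z ^ k * (w - z) ^ 2)%C.
    2: { rewrite (S_INR (S k)), RtoC_plus, !(Cpow_S _ (S k)), !(Cpow_S _ k). ring. }
    eapply Rle_trans; [apply Cmod_triangle|].
    rewrite !Cmod_mult, !Cmod_pow, Cmod_R, Rabs_pos_eq by apply pos_INR.
    assert (Hd : 0 <= Cmod (w - z) ^ 2) by apply pow2_ge_0.
    assert (Hp : Cmod z ^ k <= rho ^ k) by (apply pow_incr; lra).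
    assert (Hrn : 0 <= rho ^ n) by (apply pow_le; lra).
    assert (Hk : 0 <= INR k) by apply pos_INR.
    rewrite !S_INR in *.
    apply Rle_trans with (rho * (INR k * (INR k + 1) * rho ^ n * Cmod (w - z) ^ 2)
       + (INR k + 1) * rho ^ k * Cmod (w - z) ^ 2).
    + apply Rplus_le_compat.
      * apply Rmult_le_compat; try assumption; apply Cmod_ge_0.
      * apply Rmult_le_compat_r; [assumption|].
        apply Rmult_le_compat_l; [lra | assumption].
    + unfold k at 3 5. simpl pow.
      assert (0 <= rho * rho ^ n * Cmod (w - z) ^ 2).
      { apply Rmult_le_pos; [apply Rmult_le_pos; lra | assumption]. }
      simpl in *. nra.
Qed.

(** The Taylor remainder is dominated by the second derivative of the series of
moduli at a radius [rho] between [|z|] and [r]. *)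
Lemma pseries_quadratic z l :
  Cmod z < r -> is_Cpseries deriv_coef z l ->
  exists M delta, 0 < delta /\ forall w, Cmod (w - z) < delta ->
    Cmod (f w - f z - l * (w - z)) <= M * Cmod (w - z) ^ 2.
Proof.
  intros Hz Hl.
  pose (rho := (Cmod z + r) / 2).
  pose proof (Cmod_ge_0 z) as Hz0.
  assert (Hrho : Cmod z < rho < r) by (unfold rho; lra).
  assert (HB : ex_series (fun n => Rabs (PS_derive (PS_derive (fun n => Cmod (a n))) n * rho ^ n))).
  { apply CV_disk_inside. rewrite !CV_radius_derive, Rabs_pos_eq by lra.
    apply CV_radius_Cmod. lra. }
  destruct HB as [M HM].
  exists M, (rho - Cmod z). split; [lra|]. intros w Hw.
  assert (Hwr : Cmod w <= rho).
  { replace w with (z + (w - z))%C by ring.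
    eapply Rle_trans; [apply Cmod_triangle | lra]. }
  assert (Sw : is_Cseries (fun n => a n * w ^ n)%C (f w)).
  { apply (proj1 (is_Cpseries_iff a w _)), Hf. lra. }
  assert (Sz : is_Cseries (fun n => a n * z ^ n)%C (f z)).
  { apply (proj1 (is_Cpseries_iff a z _)), Hf. lra. }
  assert (Sl : is_Cseries (fun n => deriv_coef n * z ^ n)%C l) by exact (proj1 (is_Cpseries_iff _ _ _) Hl).
  pose (E := fun n => (a n * w ^ n - a n * z ^ n)%C).
  assert (SE : is_Cseries E (f w - f z)%C).
  { exact (is_series_minus _ _ _ _ Sw Sz). }
  (* The terms of index [0] and [1] of the remainder vanish; dropping them aligns
     the series with its second derivative. *)
  assert (SE1 : is_Cseries (fun n => E (S n)) (f w - f z)%C).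
  { apply (is_series_incr_1 E). 
    refine (eq_ind_r (fun v => is_Cseries E v) SE _).
    change ((f w - f z) + E 0%nat = f w - f z)%C. unfold E. simpl. ring. }
  pose (G := fun n => (E (S n) - (w - z) * (deriv_coef n * z ^ n))%C).
  assert (SG : is_Cseries G (f w - f z - (w - z) * l)%C).
  { exact (is_series_minus _ _ _ _ SE1 (is_series_scal (w - z)%C _ _ Sl)). }
  assert (SG1 : is_Cseries (fun n => G (S n)) (f w - f z - (w - z) * l)%C).
  { apply (is_series_incr_1 G).
    refine (eq_ind_r (fun v => is_Cseries G v) SG _).
    change ((f w - f z - (w - z) * l) + G 0%nat = f w - f z - (w - z) * l)%C.
    unfold G, E, deriv_coef. simpl. ring. }
  replace (f w - f z - l * (w - z))%C with (f w - f z - (w - z) * l)%C by ring.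
  eapply Rle_trans; [| right; apply Rmult_comm].
  eapply (is_Cseries_Cmod_le _ _ _ _ SG1 (is_series_scal (Cmod (w - z) ^ 2) _ _ HM)).
  intros n.
  change (Cmod (G (S n)) <= Cmod (w - z) ^ 2 * Rabs (PS_derive (PS_derive (fun n => Cmod (a n))) n * rho ^ n)).
  replace (G (S n)) with (a (S (S n)) *
     (w ^ S (S n) - z ^ S (S n) - RtoC (INR (S (S n))) * z ^ S n * (w - z)))%C
    by (unfold G, E, deriv_coef; ring).
  rewrite Cmod_mult.
  assert (0 <= rho ^ n) by (apply pow_le; lra).
  assert (Ha := Cmod_ge_0 (a (S (S n)))).
  rewrite Rabs_pos_eq.
  2: { unfold PS_derive. repeat apply Rmult_le_pos; try assumption; apply pos_INR. }
  eapply Rle_trans.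
  { apply Rmult_le_compat_l; [exact Ha|].
    apply (Cpow_remainder rho); [lra | exact Hwr]. }
  unfold PS_derive. right. ring.
Qed.

End PowerSeries.

(** ** Analytic functions *)

Lemma quadratic_is_derive (f : C -> C) (z l : C) (M delta : R) :
  0 < delta ->
  (forall w, Cmod (w - z) < delta ->
    Cmod (f w - f z - l * (w - z)) <= M * Cmod (w - z) ^ 2) ->
  @is_derive C_AbsRing C_NormedModule f z l.
Proof.
  intros Hd H. split.
  - apply is_linear_scal_l.
  - intros x Hx.
    apply (@is_filter_lim_locally_unique C_AbsRing (AbsRing_NormedModule C_AbsRing)) in Hx.
    subst x. intros eps.
    assert (Hp : 0 < Rmin delta (eps / (Rabs M + 1))).
    { apply Rmin_pos; [exact Hd|]. apply Rdiv_lt_0_compat; [apply cond_pos|].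
      pose proof (Rabs_pos M); lra. }
    exists (mkposreal _ Hp). intros w Hw.
    change (Cmod (w - z) < Rmin delta (eps / (Rabs M + 1))) in Hw.
    change (Cmod (f w - f z - (w - z) * l) <= eps * Cmod (w - z)).
    replace (f w - f z - (w - z) * l)%C with (f w - f z - l * (w - z))%C by ring.
    eapply Rle_trans; [apply H; eapply Rlt_le_trans; [exact Hw | apply Rmin_l]|].
    pose proof (Cmod_ge_0 (w - z)) as H0.
    pose proof (Rabs_pos M) as H1. pose proof (Rle_abs M) as H2.
    assert (Cmod (w - z) * (Rabs M + 1) <= eps).
    { apply Rle_trans with (eps / (Rabs M + 1) * (Rabs M + 1)).
      - apply Rmult_le_compat_r; [lra|]. left.
        eapply Rlt_le_trans; [exact Hw | apply Rmin_r].
      - right. field. lra. }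
    apply Rle_trans with ((Cmod (w - z) * (Rabs M + 1)) * Cmod (w - z)); [nra|].
    apply Rmult_le_compat_r; assumption.
Qed.

(** If [F - G] moves by at most [Q], and [Q] has a double zero at [t], then [F] and
[G] have the same derivative at [t]. *)
Lemma is_derive_quadratic_remainder (F G Q : R -> R) t g :
  locally t (fun s => Rabs (F s - F t - (G s - G t)) <= Q s) -> Q t = 0 ->
  is_derive G t g -> is_derive Q t 0 -> is_derive F t g.
Proof.
  intros H HQ0 HG HQ.
  assert (Hr : is_derive (fun s => F s - G s) t 0).
  { apply is_derive_Reals. apply is_derive_Reals in HQ.
    intros eps Heps. destruct (HQ eps Heps) as [d1 Hd1]. destruct H as [d2 Hd2].
    assert (Hd : 0 < Rmin d1 d2) by (apply Rmin_pos; apply cond_pos).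
    exists (mkposreal _ Hd). intros h Hh0 Hh. simpl in Hh.
    eapply Rle_lt_trans; [| apply (Hd1 h Hh0)].
    2: { eapply Rlt_le_trans; [exact Hh | apply Rmin_l]. }
    rewrite HQ0, !Rminus_0_r. unfold Rdiv. rewrite !Rabs_mult.
    apply Rmult_le_compat_r; [apply Rabs_pos|].
    eapply Rle_trans; [| apply Rle_abs].
    replace (F (t + h) - G (t + h) - (F t - G t))
      with (F (t + h) - F t - (G (t + h) - G t)) by ring.
    apply Hd2. change (Rabs (t + h - t) < d2).
    replace (t + h - t) with h by ring.
    eapply Rlt_le_trans; [exact Hh | apply Rmin_r]. }
  replace g with (g + 0) by ring.
  apply (is_derive_ext (fun s => G s + (F s - G s))); [intros s; change (G s + (F s - G s) = F s); ring|].
  exact (is_derive_plus _ _ _ _ _ HG Hr).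
Qed.

Lemma Cmod_sqr (z : C) : Cmod z ^ 2 = fst z ^ 2 + snd z ^ 2.
Proof. unfold Cmod. rewrite pow2_sqrt; nra. Qed.

Lemma Rabs_fst_le_Cmod (z : C) : Rabs (fst z) <= Cmod z.
Proof. eapply Rle_trans; [apply Rmax_l | apply Rmax_Cmod]. Qed.

Lemma Rabs_snd_le_Cmod (z : C) : Rabs (snd z) <= Cmod z.
Proof. eapply Rle_trans; [apply Rmax_r | apply Rmax_Cmod]. Qed.

Lemma Cmod_le_Rabs (z : C) : Cmod z <= Rabs (fst z) + Rabs (snd z).
Proof.
  apply Rsqr_incr_0_var.
  - rewrite !Rsqr_pow2, Cmod_sqr. rewrite <- (pow2_abs (fst z)), <- (pow2_abs (snd z)).
    pose proof (Rabs_pos (fst z)). pose proof (Rabs_pos (snd z)). nra.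
  - pose proof (Rabs_pos (fst z)). pose proof (Rabs_pos (snd z)). lra.
Qed.

(** Along a curve the quadratic remainder is dominated by the squared increment of
the curve, whose derivative vanishes. *)
Lemma quadratic_cdiff (f : C -> C) (z l : C) (M delta : R) :
  0 < delta ->
  (forall w, Cmod (w - z) < delta ->
    Cmod (f w - f z - l * (w - z)) <= M * Cmod (w - z) ^ 2) ->
  cdiff f z l.
Proof.
  intros Hd H zeta t d E Hz.
  assert (Hlz := cder_mult _ _ _ _ _ (cder_const l t) Hz).
  destruct (cder_components zeta) as (u & v & ->).
  simpl in E. subst z.
  destruct Hz as [Hu Hv]. simpl in Hu, Hv.
  set (Q := fun s => M * ((u s - u t) ^ 2 + (v s - v t) ^ 2)).
  assert (HQ : is_derive Q t 0).
  { unfold Q. auto_derive; [split; [eexists; exact Hu|split; [eexists; exact Hv | exact I]]|].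
    ring. }
  assert (HQ0 : Q t = 0) by (unfold Q; ring).
  assert (Hloc : locally t (fun s =>
    Cmod (f (u s, v s) - f (u t, v t) - l * ((u s, v s) - (u t, v t))) <= Q s)).
  { assert (Hcu : continuous u t)
      by (apply (ex_derive_continuous (V := R_NormedModule)); eexists; exact Hu).
    assert (Hcv : continuous v t)
      by (apply (ex_derive_continuous (V := R_NormedModule)); eexists; exact Hv).
    assert (Hd2 : 0 < delta / 2) by lra.
    assert (K := filter_and _ _ (proj1 (filterlim_locally u (u t)) Hcu (mkposreal _ Hd2))
              (proj1 (filterlim_locally v (v t)) Hcv (mkposreal _ Hd2))).
    refine (filter_imp _ _ _ K). intros s [K1 K2].
    change (Rabs (u s - u t) < delta / 2) in K1. change (Rabs (v s - v t) < delta / 2) in K2.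
    eapply Rle_trans; [apply H|].
    - eapply Rle_lt_trans; [apply Cmod_le_Rabs|]. simpl.
      unfold Rminus in K1, K2. lra.
    - unfold Q. rewrite Cmod_sqr. right. simpl. ring. }
  destruct Hlz as [Hlz1 Hlz2].
  replace (0 * (u t, v t) + l * d)%C with (l * d)%C in * by ring.
  split.
  - refine (is_derive_quadratic_remainder (fun s => fst (f (u s, v s)))
      (fun s => fst (l * (u s, v s))%C) Q t _ _ HQ0 Hlz1 HQ).
    refine (filter_imp _ _ _ Hloc). intros s Hs.
    eapply Rle_trans; [| exact Hs].
    eapply Rle_trans; [| apply Rabs_fst_le_Cmod]. right. f_equal. simpl. ring.
  - refine (is_derive_quadratic_remainder (fun s => snd (f (u s, v s)))
      (fun s => snd (l * (u s, v s))%C) Q t _ _ HQ0 Hlz2 HQ).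
    refine (filter_imp _ _ _ Hloc). intros s Hs.
    eapply Rle_trans; [| exact Hs].
    eapply Rle_trans; [| apply Rabs_snd_le_Cmod]. right. f_equal. simpl. ring.
Qed.

Lemma is_derive_cont2 (f : C -> C) (z l : C) :
  @is_derive C_AbsRing C_NormedModule f z l -> cont2 f z.
Proof.
  intros H.
  assert (Hc : @filterlim C C f (@locally C_UniformSpace z) (@locally C_UniformSpace (f z))).
  { intros P HP. apply locally_C.
    exact (ex_derive_continuous (V := C_NormedModule) f z (ex_intro _ l H) P HP). }
  destruct z as [x y].
  split; apply continuity_2d_pt_filterlim; simpl.
  - apply (filterlim_ext (fun z => fst (f z))).
    { intros s. now rewrite <- surjective_pairing. }
    refine (filterlim_comp _ _ _ f fst _ _ _ Hc _). apply continuous_fst.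
  - apply (filterlim_ext (fun z => snd (f z))).
    { intros s. now rewrite <- surjective_pairing. }
    refine (filterlim_comp _ _ _ f snd _ _ _ Hc _). apply continuous_snd.
Qed.

(** The derived series represents [C_derive f] on the whole disc, so analyticity
passes to the derivative. *)
Lemma analytic_at_deriv (f : C -> C) (z0 : C) :
  analytic_at f z0 ->
  analytic_at (C_derive f) z0 /\
  exists r : posreal, forall z, Cmod (z - z0) < r ->
    cdiff f z (C_derive f z) /\ cont2 f z.
Proof.
  intros (a & r & Ha).
  assert (Hf : forall u, Cmod u < r -> is_Cpseries a u (f (z0 + u)%C)).
  { intros u Hu. replace u with (z0 + u - z0)%C at 1 by ring. apply Ha.
    now replace (z0 + u - z0)%C with u by ring. }
  assert (K : forall z, Cmod (z - z0) < r ->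
    is_Cpseries (deriv_coef a) (z - z0)%C (C_derive f z) /\
    cdiff f z (C_derive f z) /\ cont2 f z).
  { intros z Hz.
    destruct (deriv_series_converges a r _ Hf _ Hz) as [l Hl].
    destruct (pseries_quadratic a r _ Hf _ _ Hz Hl) as (M & delta & Hd & HM).
    assert (HQ : forall w, Cmod (w - z) < delta ->
      Cmod (f w - f z - l * (w - z)) <= M * Cmod (w - z) ^ 2).
    { intros w Hw. specialize (HM (w - z0)%C).
      replace (w - z0 - (z - z0))%C with (w - z)%C in HM by ring.
      replace (z0 + (w - z0))%C with w in HM by ring.
      replace (z0 + (z - z0))%C with z in HM by ring. now apply HM. }
    assert (HD := quadratic_is_derive f z l M delta Hd HQ).
    rewrite (is_C_derive_unique f z l HD).
    split; [exact Hl | split].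
    - exact (quadratic_cdiff f z l M delta Hd HQ).
    - exact (is_derive_cont2 f z l HD). }
  split.
  - exists (deriv_coef a), r. intros z Hz. now apply K.
  - exists r. intros z Hz. now apply K.
Qed.

Lemma analytic_at_holo (f : C -> C) (z : C) :
  analytic_at f z -> holo f (C_derive f) z.
Proof.
  intros H. destruct (analytic_at_deriv f z H) as [H1 [r Hr]].
  destruct (analytic_at_deriv _ z H1) as [_ [r1 Hr1]].
  assert (Hz : Cmod (z - z) = 0).
  { replace (z - z)%C with (RtoC 0) by ring. apply Cmod_0. }
  split; [|split].
  - assert (Hr2 : 0 < r / 2) by (pose proof (cond_pos r); lra).
    exists (mkposreal _ Hr2). intros u v Hu Hv. simpl in Hu, Hv.
    apply Hr. eapply Rle_lt_trans; [apply Cmod_le_Rabs|]. simpl.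
    unfold Rminus in Hu, Hv. lra.
  - apply Hr. rewrite Hz. apply cond_pos.
  - apply Hr1. rewrite Hz. apply cond_pos.
Qed.

(** * The kernel [g(z) = sigma(iz) exp(2 pi i z)] and its logarithm *)

(** This is [sigma] at [i z]. *)
Definition sigma_rot (p : R) (z : C) : C := ((RtoC p + Ci * z) * / (RtoC p - Ci * z))%C.
Definition exp_2ipi (z : C) : C := Cexp (RtoC (2 * PI) * Ci * z)%C.
Definition kernel (p : R) (z : C) : C := (sigma_rot p z * exp_2ipi z)%C.
Definition dkernel (p : R) (z : C) : C :=
  ((RtoC (2 * PI) * Ci * sigma_rot p z
    + RtoC (2 * p) * Ci * (/ (RtoC p - Ci * z) * / (RtoC p - Ci * z))) * exp_2ipi z)%C.
Definition log_kernel (p : R) (z : C) : C := Clog (1 - kernel p z)%C.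
Definition dlog_kernel (p : R) (z : C) : C := (- dkernel p z * / (1 - kernel p z))%C.

Lemma fst_one_minus (g : C) : fst (1 - g)%C = 1 - fst g.
Proof. destruct g; reflexivity. Qed.

Lemma den_neq0 p z : - p < snd z -> (RtoC p - Ci * z)%C <> 0%C.
Proof.
  intros H E. apply (f_equal fst) in E. destruct z as [x y]; simpl in *. lra.
Qed.

Lemma cdiff_kernel p z : - p < snd z -> cdiff (kernel p) z (dkernel p z).
Proof.
  intros H. pose proof (den_neq0 p z H) as H0.
  eapply cdiff_eq.
  - unfold kernel, sigma_rot, exp_2ipi.
    apply cdiff_mult; [apply cdiff_mult
      |apply cdiff_Cexp; apply cdiff_mult; [apply cdiff_const | apply cdiff_id]].
    + apply cdiff_plus; [apply cdiff_const|].
      apply cdiff_mult; [apply cdiff_const | apply cdiff_id].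
    + apply (cdiff_inv (fun z => RtoC p - Ci * z)%C); [|exact H0].
      apply cdiff_minus; [apply cdiff_const|].
      apply cdiff_mult; [apply cdiff_const | apply cdiff_id].
  - unfold dkernel, sigma_rot. fold (exp_2ipi z). rewrite RtoC_mult, (RtoC_mult 2 p). field. exact H0.
Qed.

Lemma cont2_sigma_rot p z : - p < snd z -> cont2 (sigma_rot p) z.
Proof.
  intros H. unfold sigma_rot. apply cont2_mult.
  - apply cont2_plus; [apply cont2_const|].
    apply cont2_mult; [apply cont2_const | apply cont2_id].
  - apply cont2_inv; [|now apply den_neq0].
    apply cont2_minus; [apply cont2_const|].
    apply cont2_mult; [apply cont2_const | apply cont2_id].
Qed.

Lemma cont2_exp_2ipi z : cont2 exp_2ipi z.
Proof. apply cont2_Cexp. apply cont2_mult; [apply cont2_const | apply cont2_id]. Qed.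

Lemma cont2_kernel p z : - p < snd z -> cont2 (kernel p) z.
Proof. intros H. apply cont2_mult; [now apply cont2_sigma_rot | apply cont2_exp_2ipi]. Qed.

Lemma cont2_dkernel p z : - p < snd z -> cont2 (dkernel p) z.
Proof.
  intros H.
  assert (cont2 (fun z => / (RtoC p - Ci * z))%C z).
  { apply cont2_inv; [|now apply den_neq0].
    apply cont2_minus; [apply cont2_const|].
    apply cont2_mult; [apply cont2_const | apply cont2_id]. }
  apply cont2_mult; [|apply cont2_exp_2ipi].
  apply cont2_plus; apply cont2_mult.
  - apply cont2_const.
  - now apply cont2_sigma_rot.
  - apply cont2_const.
  - now apply cont2_mult.
Qed.

Lemma one_minus_kernel_neq0 p z : fst (kernel p z) < 1 -> (1 - kernel p z)%C <> 0%C.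
Proof.
  intros H E. apply (f_equal fst) in E. rewrite fst_one_minus in E.
  change (1 - fst (kernel p z) = 0) in E. lra.
Qed.

(** Where [Re g < 1], the principal logarithm of [1 - g] is available; this includes
the points of the real axis that are not zeros of [1 - g]. *)
Lemma holo_log_kernel p z : - p < snd z -> fst (kernel p z) < 1 -> holo (log_kernel p) (dlog_kernel p) z.
Proof.
  intros H1 H2.
  assert (Hd : forall z, - p < snd z -> fst (kernel p z) < 1 -> cdiff (log_kernel p) z (dlog_kernel p z)).
  { clear. intros z H1 H2. eapply cdiff_eq.
    - apply (cdiff_Clog (fun z => 1 - kernel p z)%C).
      + apply cdiff_minus; [apply cdiff_const | now apply cdiff_kernel].
      + rewrite fst_one_minus. lra.
    - unfold dlog_kernel. field. now apply one_minus_kernel_neq0. }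
  assert (Hc : cont2 (fun z => 1 - kernel p z)%C z).
  { apply cont2_minus; [apply cont2_const | now apply cont2_kernel]. }
  split; [|split].
  - destruct z as [x y]. change (- p < y) in H1. cbn [fst snd].
    destruct (cont2_kernel p (x, y) H1) as [HG _].
    assert (He : 0 < 1 - fst (kernel p (x, y))) by lra.
    destruct (HG (mkposreal _ He)) as [d1 Hd1].
    assert (Hm : 0 < Rmin d1 (p + y)) by (apply Rmin_pos; [apply cond_pos | lra]).
    exists (mkposreal _ Hm). intros u v Hu Hv. simpl in Hu, Hv.
    pose proof (Rmin_l d1 (p + y)). pose proof (Rmin_r d1 (p + y)).
    apply Hd.
    + apply Rabs_def2 in Hv. destruct Hv as [Hv1 Hv2]. simpl. lra.
    + assert (K : Rabs (fst (kernel p (u, v)) - fst (kernel p (x, y))) < 1 - fst (kernel p (x, y)))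
        by (apply Hd1; simpl; lra).
      apply Rabs_def2 in K. destruct K as [K1 K2]. lra.
  - apply cont2_Clog; [exact Hc | rewrite fst_one_minus; lra].
  - apply cont2_mult.
    + apply cont2_opp. now apply cont2_dkernel.
    + apply cont2_inv; [exact Hc | now apply one_minus_kernel_neq0].
Qed.

(** ** Size of the kernel *)

Lemma sigma_rot_eq p x y :
  0 < p -> 0 <= y ->
  sigma_rot p (x, y) = ((p ^ 2 - x ^ 2 - y ^ 2) / ((p + y) ^ 2 + x ^ 2),
                  2 * p * x / ((p + y) ^ 2 + x ^ 2)).
Proof.
  intros Hp Hy. assert (0 < (p + y) ^ 2 + x ^ 2) by nra.
  unfold sigma_rot. apply injective_projections; simpl; field; simpl; nra.
Qed.

Lemma exp_2ipi_eq x y :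
  exp_2ipi (x, y) = (exp (- (2 * PI * y)) * cos (2 * PI * x),
               exp (- (2 * PI * y)) * sin (2 * PI * x)).
Proof.
  unfold exp_2ipi, Cexp. simpl.
  apply injective_projections; simpl; f_equal; f_equal; ring.
Qed.

Lemma Cmod_exp_2ipi x y : Cmod (exp_2ipi (x, y)) = exp (- (2 * PI * y)).
Proof.
  rewrite exp_2ipi_eq. unfold Cmod. cbn [fst snd].
  pose proof (exp_pos (- (2 * PI * y))).
  rewrite <- (sqrt_pow2 (exp (- (2 * PI * y)))) at 3 by lra.
  f_equal. rewrite !Rpow_mult_distr, <- Rmult_plus_distr_l.
  pose proof (sin2_cos2 (2 * PI * x)) as Hsc. unfold Rsqr in Hsc.
  simpl. rewrite !Rmult_1_r. nra.
Qed.

Lemma Cmod_sigma_rot_le p x y : 0 < p -> 0 <= y -> Cmod (sigma_rot p (x, y)) <= 1.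
Proof.
  intros Hp Hy. assert (HQ : 0 < (p + y) ^ 2 + x ^ 2) by nra.
  apply Rsqr_incr_0_var; [|lra].
  rewrite Rsqr_pow2, Cmod_sqr, sigma_rot_eq by assumption. cbn [fst snd].
  set (Q := (p + y) ^ 2 + x ^ 2) in *.
  replace (((p ^ 2 - x ^ 2 - y ^ 2) / Q) ^ 2 + (2 * p * x / Q) ^ 2)
    with (((p - y) ^ 2 + x ^ 2) / Q).
  - apply (Rmult_le_reg_r Q); [exact HQ|].
    replace (((p - y) ^ 2 + x ^ 2) / Q * Q) with ((p - y) ^ 2 + x ^ 2) by (field; lra).
    assert (0 <= p * y) by (apply Rmult_le_pos; lra).
    unfold Q, Rsqr. lra.
  - apply (Rmult_eq_reg_r (Q ^ 2)); [|nra]. field_simplify; [|lra|lra]. unfold Q. ring.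
Qed.

Lemma Cmod_kernel_le p x y : 0 < p -> 0 <= y -> Cmod (kernel p (x, y)) <= exp (- (2 * PI * y)).
Proof.
  intros Hp Hy. unfold kernel. rewrite Cmod_mult, Cmod_exp_2ipi.
  pose proof (Cmod_sigma_rot_le p x y Hp Hy). pose proof (exp_pos (- (2 * PI * y))).
  pose proof (Cmod_ge_0 (sigma_rot p (x, y))). nra.
Qed.

Lemma Cmod_kernel_lt1 p x y : 0 < p -> 0 < y -> Cmod (kernel p (x, y)) < 1.
Proof.
  intros Hp Hy. eapply Rle_lt_trans; [apply Cmod_kernel_le; lra|].
  rewrite <- exp_0. apply exp_increasing. pose proof PI_RGT_0. nra.
Qed.

Lemma fst_kernel_lt1 p x y : 0 < p -> 0 < y -> fst (kernel p (x, y)) < 1.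
Proof.
  intros Hp Hy. eapply Rle_lt_trans; [apply Rle_abs|].
  eapply Rle_lt_trans; [apply Rabs_fst_le_Cmod | now apply Cmod_kernel_lt1].
Qed.

Lemma Cmod_dkernel_le p x y :
  0 < p -> 0 <= y -> Cmod (dkernel p (x, y)) <= (2 * PI + 2 / p) * exp (- (2 * PI * y)).
Proof.
  intros Hp Hy. unfold dkernel. rewrite Cmod_mult, Cmod_exp_2ipi.
  apply Rmult_le_compat_r; [left; apply exp_pos|].
  eapply Rle_trans; [apply Cmod_triangle|].
  assert (Hd : Cmod (/ (RtoC p - Ci * (x, y))) <= / p).
  { rewrite Cmod_inv by (apply den_neq0; simpl; lra). apply Rinv_le_contravar; [exact Hp|].
    eapply Rle_trans; [| apply Rabs_fst_le_Cmod]. simpl.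
    eapply Rle_trans; [|apply Rle_abs]. lra. }
  pose proof (Cmod_ge_0 (/ (RtoC p - Ci * (x, y)))).
  pose proof PI_RGT_0. pose proof (Cmod_sigma_rot_le p x y Hp Hy).
  rewrite !Cmod_mult, !Cmod_R, Cmod_Ci, !Rabs_pos_eq by lra.
  apply Rplus_le_compat; [nra|].
  apply Rle_trans with (2 * p * 1 * (/ p * / p)); [|right; field; lra].
  apply Rmult_le_compat_l; [lra|]. apply Rmult_le_compat; assumption.
Qed.

Lemma Cmod_one_minus_ge (g : C) : 1 - Cmod g <= Cmod (1 - g).
Proof.
  assert (H : Cmod 1 <= Cmod (1 - g) + Cmod g).
  { replace (RtoC 1) with ((1 - g) + g)%C at 1 by ring. apply Cmod_triangle. }
  rewrite Cmod_1 in H. lra.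
Qed.

(** The bound applies on the right side with [m = 1] and on the top side with
[m = 1 / 2]. *)
Lemma Cmod_dlog_kernel_le p x y m :
  0 < p -> 0 <= y -> 0 < m -> m <= Cmod (1 - kernel p (x, y)) ->
  Cmod (dlog_kernel p (x, y)) <= (2 * PI + 2 / p) / m * exp (- (2 * PI * y)).
Proof.
  intros Hp Hy Hm H. unfold dlog_kernel.
  rewrite Cmod_mult, Cmod_opp, Cmod_inv by (apply Cmod_gt_0; lra).
  assert (Hi : / Cmod (1 - kernel p (x, y)) <= / m) by now apply Rinv_le_contravar.
  assert (0 < / Cmod (1 - kernel p (x, y))) by (apply Rinv_0_lt_compat; lra).
  replace ((2 * PI + 2 / p) / m * exp (- (2 * PI * y)))
    with ((2 * PI + 2 / p) * exp (- (2 * PI * y)) * / m) by (unfold Rdiv; ring).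
  apply Rmult_le_compat; [apply Cmod_ge_0 | lra | now apply Cmod_dkernel_le | exact Hi].
Qed.

Lemma Rabs_atan_le (v : R) : Rabs (atan v) <= Rabs v.
Proof.
  destruct (MVT_gen atan 0 v (fun x => / (1 + x ^ 2))) as (c & _ & Hc).
  - intros x _. auto_derive; [exact I | unfold Rsqr; field; nra].
  - intros x _. apply derivable_continuous_pt, derivable_pt_atan.
  - rewrite atan_0, !Rminus_0_r in Hc. rewrite Hc, Rabs_mult.
    assert (H : 0 < / (1 + c ^ 2) <= 1).
    { split; [apply Rinv_0_lt_compat; nra|].
      rewrite <- Rinv_1. apply Rinv_le_contravar; nra. }
    rewrite (Rabs_pos_eq (/ _)) by lra. pose proof (Rabs_pos v). nra.
Qed.

(** From [1 - 1/m <= ln m <= m - 1] with [m = |1 - g|^2 >= 1/4], and [|atan v| <= |v|]. *)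
Lemma Clog_small (g : C) : Cmod g <= 1 / 2 -> Cmod (Clog (1 - g)) <= 6 * Cmod g.
Proof.
  intros Hg. set (s := Cmod g) in *.
  assert (Hs : 0 <= s) by apply Cmod_ge_0.
  assert (H1 : Rabs (fst g) <= s) by apply Rabs_fst_le_Cmod.
  assert (H2 : Rabs (snd g) <= s) by apply Rabs_snd_le_Cmod.
  assert (Hss : fst g ^ 2 + snd g ^ 2 = s ^ 2) by (symmetry; apply Cmod_sqr).
  eapply Rle_trans; [apply Cmod_le_Rabs|].
  replace (6 * s) with (4 * s + 2 * s) by ring.
  destruct g as [a b]. unfold Clog. simpl in *.
  apply Rabs_le_between in H1. apply Rabs_le_between in H2.
  apply Rplus_le_compat.
  - set (m := (1 + - a) * ((1 + - a) * 1) + (0 + - b) * ((0 + - b) * 1)).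
    assert (Hm : m = 1 - 2 * a + s ^ 2) by (unfold m; simpl; nra).
    assert (Hm4 : 1 / 4 <= m) by nra.
    assert (Hu : ln m <= m - 1).
    { pose proof (exp_ineq1_le (ln m)). rewrite exp_ln in H by lra. lra. }
    assert (Hl : - ln m <= / m - 1).
    { rewrite <- ln_Rinv by lra. pose proof (exp_ineq1_le (ln (/ m))).
      rewrite exp_ln in H by (apply Rinv_0_lt_compat; lra). lra. }
    assert (Hi : / m - 1 <= 8 * s).
    { apply (Rmult_le_reg_r m); [lra|].
      rewrite Rmult_minus_distr_r, Rinv_l by lra. nra. }
    apply Rabs_le. nra.
  - rewrite <- (Rabs_pos_eq (2 * s)) by lra.
    set (v := (0 + - b) / (1 + - a)).
    assert (Hv : Rabs v <= 2 * s).
    { unfold v, Rdiv. rewrite Rabs_mult, Rabs_inv, (Rabs_pos_eq (1 + - a)) by lra.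
      apply (Rmult_le_reg_r (1 + - a)); [lra|].
      rewrite Rmult_assoc, Rinv_l, Rmult_1_r by lra.
      assert (Rabs (0 + - b) <= s) by (apply Rabs_le; lra). nra. }
    rewrite (Rabs_pos_eq (2 * s)) by lra. eapply Rle_trans; [|exact Hv].
    apply Rabs_atan_le.
Qed.

Lemma kernel_vertical p t : 0 < p -> 0 < t ->
  kernel p (0, t) = RtoC (sigma_ratio p (- t) * exp (- (2 * PI * t))).
Proof.
  intros Hp Ht. unfold kernel. rewrite sigma_rot_eq, exp_2ipi_eq by lra. unfold sigma_ratio.
  rewrite (Rmult_0_r (2 * PI)), cos_0, sin_0.
  apply injective_projections; simpl; field; nra.
Qed.

Lemma log_kernel_vertical p t : 0 < p -> 0 < t ->
  log_kernel p (0, t) = RtoC (ln (1 - sigma_ratio p (- t) * exp (- (2 * PI * t)))).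
Proof.
  intros Hp Ht. pose proof (fst_kernel_lt1 p 0 t Hp Ht) as Hg.
  unfold log_kernel. rewrite kernel_vertical in * by assumption. simpl in Hg.
  set (g := sigma_ratio p (- t) * exp (- (2 * PI * t))) in *.
  unfold Clog. simpl. apply injective_projections; simpl.
  - replace ((1 + - g) * ((1 + - g) * 1) + (0 + - 0) * ((0 + - 0) * 1))
      with ((1 - g) * (1 - g)) by ring.
    rewrite ln_mult by lra. field.
  - replace ((0 + - 0) / (1 + - g)) with 0 by (field; lra). apply atan_0.
Qed.

(** On [Re z = N] the factor [exp (2 pi i z)] is positive, and
    [Re (sigma (i z)) <= 0] because its numerator is [p^2 - N^2 - y^2]. *)
Lemma Cmod_one_minus_kernel_integer p (N : nat) y :
  0 < p -> p <= INR N -> 0 <= y ->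
  fst (kernel p (INR N, y)) < 1 /\ 1 <= Cmod (1 - kernel p (INR N, y)).
Proof.
  intros Hp HN Hy.
  assert (Hc : cos (2 * PI * INR N) = 1).
  { replace (2 * PI * INR N) with (0 + 2 * INR N * PI) by ring.
    rewrite cos_period. apply cos_0. }
  assert (Hs : sin (2 * PI * INR N) = 0).
  { replace (2 * PI * INR N) with (0 + 2 * INR N * PI) by ring.
    rewrite sin_period. apply sin_0. }
  assert (H : fst (kernel p (INR N, y)) <= 0).
  { unfold kernel. rewrite sigma_rot_eq, exp_2ipi_eq, Hc, Hs by assumption. unfold Cmult; cbn [fst snd].
    assert (0 < (p + y) ^ 2 + INR N ^ 2) by nra.
    assert (0 < / ((p + y) ^ 2 + INR N ^ 2)) by now apply Rinv_0_lt_compat.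
    pose proof (exp_pos (- (2 * PI * y))).
    unfold Rdiv. assert (p ^ 2 - INR N ^ 2 - y ^ 2 <= 0) by nra.
    set (q := / ((p + y) ^ 2 + INR N ^ 2)) in *.
    assert ((p ^ 2 - INR N ^ 2 - y ^ 2) * q <= 0) by nra.
    apply Rle_trans with ((p ^ 2 - INR N ^ 2 - y ^ 2) * q * exp (- (2 * PI * y))); [right; ring | nra]. }
  split; [lra|].
  eapply Rle_trans; [|apply Rabs_fst_le_Cmod].
  eapply Rle_trans; [|apply Rle_abs]. rewrite fst_one_minus. lra.
Qed.

(** Since [|1 - g| >= y], the logarithm of the modulus is at least [ln y], and
[- ln y <= 2 / sqrt y]; the argument is bounded. *)
Lemma Cmod_log_kernel_le p x y :
  0 < p -> 0 < y <= 1 / 2 -> Cmod (log_kernel p (x, y)) <= 4 + 2 / sqrt y.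
Proof.
  intros Hp Hy.
  pose proof (Cmod_kernel_le p x y Hp ltac:(lra)) as Hg.
  set (g := kernel p (x, y)) in *.
  assert (Hsy : 0 < sqrt y) by (apply sqrt_lt_R0; lra).
  assert (Hlow : y <= Cmod (1 - g)).
  { eapply Rle_trans; [|apply Cmod_one_minus_ge].
    assert (He : exp (- (2 * PI * y)) <= / (1 + 2 * PI * y)).
    { rewrite exp_Ropp. apply Rinv_le_contravar; [pose proof PI_RGT_0; nra|].
      apply exp_ineq1_le. }
    assert (/ (1 + 2 * PI * y) <= 1 - y).
    { assert (3 < PI) by (pose proof PI2_3_2; lra).
      apply (Rmult_le_reg_r (1 + 2 * PI * y)); [nra|].
      rewrite Rinv_l by nra.
      assert (0 <= y * (2 * PI * (1 - y) - 1)) by (apply Rmult_le_pos; nra). lra. }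
    lra. }
  assert (Hup : Cmod (1 - g) <= 2).
  { unfold Cminus. eapply Rle_trans; [apply Cmod_triangle|].
    rewrite Cmod_1, Cmod_opp.
    assert (exp (- (2 * PI * y)) <= 1).
    { rewrite <- exp_0. left. apply exp_increasing. pose proof PI_RGT_0. nra. }
    lra. }
  eapply Rle_trans; [apply Cmod_le_Rabs|].
  unfold log_kernel. fold g. unfold Clog. cbn [fst snd].
  rewrite <- Cmod_sqr.
  set (m := Cmod (1 - g)) in *.
  assert (Hm : ln (m ^ 2) = 2 * ln m) by (simpl; rewrite Rmult_1_r, ln_mult by lra; ring).
  rewrite Hm.
  assert (H1 : ln m <= 1).
  { pose proof (exp_ineq1_le (ln m)). rewrite exp_ln in H by lra. lra. }
  assert (H2 : - (2 / sqrt y) <= ln m).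
  { apply Rle_trans with (ln y).
    - assert (Hr : 0 < / sqrt y) by now apply Rinv_0_lt_compat.
      pose proof (exp_ineq1_le (ln (/ sqrt y))) as H. rewrite exp_ln in H by exact Hr.
      rewrite <- (sqrt_sqrt y) at 2 by lra.
      rewrite ln_mult by assumption. rewrite ln_Rinv in H by assumption.
      unfold Rdiv. lra.
    - destruct (Rle_lt_or_eq_dec _ _ Hlow) as [h | <-]; [left; apply ln_increasing; lra | lra]. }
  assert (H3 : 0 < 2 / sqrt y) by (apply Rdiv_lt_0_compat; lra).
  assert (H4 : Rabs (/ 2 * (2 * ln m)) <= 1 + 2 / sqrt y) by (apply Rabs_le; lra).
  set (v := snd (1 - g)%C / fst (1 - g)%C).
  assert (H5 : Rabs (atan v) <= 3).
  { pose proof (atan_bound v). pose proof PI_4. apply Rabs_le. lra. }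
  lra.
Qed.

(** The value of [Im log(1 - g)] on the real axis between the [n]-th and the
[(n+1)]-st zero, where it increases from [- pi / 2] to [pi / 2]. *)
Definition branch (p : R) (n : nat) (x : R) : R :=
  PI * x + atan (x / p) - PI * INR n - PI / 2.

Lemma is_derive_branch p n x :
  0 < p ->
  is_derive (branch p n) x (PI * ((p * (p + 1 / PI) + x ^ 2) / (p ^ 2 + x ^ 2))).
Proof.
  intros Hp. unfold branch. auto_derive; [exact I|].
  pose proof PI_RGT_0. unfold Rsqr. field. repeat split; nra.
Qed.

Lemma branch_increasing p n x y : 0 < p -> x < y -> branch p n x < branch p n y.
Proof.
  intros Hp Hxy. unfold branch. pose proof PI_RGT_0.
  assert (atan (x / p) < atan (y / p)).
  { apply atan_increasing. unfold Rdiv. apply Rmult_lt_compat_r; [now apply Rinv_0_lt_compat | exact Hxy]. }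
  nra.
Qed.

Lemma sin_cos_nPI x n :
  sin (x + 2 * INR n * PI) = sin x /\ cos (x + 2 * INR n * PI) = cos x.
Proof. split; [apply sin_period | apply cos_period]. Qed.

(** [g = exp (i theta)] on the real axis, with
    [theta = 2 pi x + 2 atan (x / p) = 2 branch + pi + 2 pi n]. *)
Lemma kernel_real p n x :
  0 < p -> kernel p (x, 0) = (- cos (2 * branch p n x), - sin (2 * branch p n x)).
Proof.
  intros Hp.
  set (a := atan (x / p)).
  assert (Hs : 0 < 1 + (x / p)²) by (pose proof (Rle_0_sqr (x / p)); lra).
  assert (Hq : 0 < sqrt (1 + (x / p)²)) by now apply sqrt_lt_R0.
  assert (Hq2 : sqrt (1 + (x / p)²) ^ 2 = 1 + (x / p)²) by (apply pow2_sqrt; lra).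
  assert (Hc : cos a = 1 / sqrt (1 + (x / p)²)) by apply cos_atan.
  assert (Hsn : sin a = (x / p) / sqrt (1 + (x / p)²)) by apply sin_atan.
  assert (E : sigma_rot p (x, 0) = (cos (2 * a), sin (2 * a))).
  { rewrite sigma_rot_eq by lra. rewrite cos_2a, sin_2a, Hc, Hsn.
    set (q := sqrt (1 + (x / p)²)) in *.
    assert (Hq3 : 1 / q * (1 / q) = p ^ 2 / (p ^ 2 + x ^ 2)).
    { replace (1 / q * (1 / q)) with (/ q ^ 2) by (field; lra).
      rewrite Hq2. unfold Rsqr. field. split; nra. }
    apply injective_projections; cbn [fst snd].
    - replace (1 / q * (1 / q) - x / p / q * (x / p / q))
        with ((1 - (x / p) * (x / p)) * (1 / q * (1 / q))) by (field; lra).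
      rewrite Hq3. field. split; nra.
    - replace (2 * (x / p / q) * (1 / q))
        with (2 * (x / p) * (1 / q * (1 / q))) by (field; lra).
      rewrite Hq3. field. split; nra. }
  assert (Et : 2 * a + 2 * PI * x = (2 * branch p n x + PI) + 2 * INR n * PI).
  { unfold branch. fold a. lra. }
  unfold kernel. rewrite E, exp_2ipi_eq.
  replace (- (2 * PI * 0)) with 0 by ring. rewrite exp_0, !Rmult_1_l.
  unfold Cmult; cbn [fst snd].
  rewrite <- neg_cos, <- neg_sin.
  destruct (sin_cos_nPI (2 * branch p n x + PI) n) as [<- <-].
  rewrite <- Et, cos_plus, sin_plus.
  apply injective_projections; cbn [fst snd]; ring.
Qed.

(** For [g = exp (i theta)] the number [(1 - cos theta, - sin theta)] has argument
[(theta - pi) / 2], reduced to the interval [(- pi / 2, pi / 2)]. *)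
Lemma snd_log_kernel_real p n x :
  0 < p -> - (PI / 2) < branch p n x < PI / 2 ->
  fst (kernel p (x, 0)) < 1 /\ snd (log_kernel p (x, 0)) = branch p n x.
Proof.
  intros Hp Ha. set (a := branch p n x) in *.
  assert (Hc : 0 < cos a) by (apply cos_gt_0; lra).
  assert (E := kernel_real p n x Hp). fold a in E.
  rewrite cos_2a_cos, sin_2a in E.
  split.
  - rewrite E. cbn [fst]. nra.
  - unfold log_kernel. rewrite E. unfold Clog. simpl.
    transitivity (atan (tan a)); [f_equal; unfold tan; field; split; nra | apply atan_tan; lra].
Qed.

Lemma tan_minus_nPI x n : cos x <> 0 -> tan (x - PI * INR n) = tan x.
Proof.
  intros Hc. induction n as [|n IH].
  - simpl. f_equal. ring.
  - rewrite <- IH, S_INR. unfold tan.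
    replace (x - PI * INR n) with (x - PI * (INR n + 1) + PI) by ring.
    rewrite neg_sin, neg_cos.
    destruct (Req_dec (cos (x - PI * (INR n + 1))) 0) as [-> | H].
    + rewrite Ropp_0. unfold Rdiv. rewrite Rinv_0. ring.
    + field. exact H.
Qed.

(** The bounds on [l] select the branch of the tangent: [pi l - pi n] lies in
[(- pi / 2, 0)], so it equals [- atan (l / p)]. *)
Lemma root_angle p n l :
  0 < p -> (1 <= n)%nat -> INR n - 1 / 2 < l < INR n -> tan (PI * l) = - l / p ->
  PI * l + atan (l / p) = PI * INR n.
Proof.
  intros Hp Hn Hl Ht. pose proof PI_RGT_0.
  assert (Hb : - (PI / 2) < PI * l - PI * INR n < PI / 2) by nra.
  destruct (Req_dec (cos (PI * l)) 0) as [Hc|Hc].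
  - exfalso. unfold tan in Ht. rewrite Hc in Ht. unfold Rdiv in Ht.
    rewrite Rinv_0, Rmult_0_r in Ht.
    assert (0 < l). { apply le_INR in Hn. simpl in Hn. lra. }
    assert (0 < / p) by now apply Rinv_0_lt_compat. nra.
  - rewrite <- (tan_minus_nPI _ n Hc) in Ht.
    assert (E := atan_tan _ Hb). rewrite Ht in E.
    replace (- l / p) with (- (l / p)) in E by (field; lra).
    rewrite atan_opp in E. lra.
Qed.

(** * Contour identity *)

Lemma Cmod_CInt_le (f : R -> C) (g : R -> R) a b l m :
  a <= b -> (forall t, a <= t <= b -> Cmod (f t) <= g t) ->
  is_CInt f a b l -> is_RInt g a b m -> Cmod l <= m.
Proof.
  intros Hab H Hf Hg. rewrite <- norm_C.
  refine (norm_RInt_le (V := C_R_NormedModule) f g a b l m Hab _ Hf Hg).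
  intros t Ht. rewrite norm_C. now apply H.
Qed.

Lemma Cmod_CInt_le_const (f : R -> C) M a b l :
  a <= b -> (forall t, a <= t <= b -> Cmod (f t) <= M) ->
  is_CInt f a b l -> Cmod l <= (b - a) * M.
Proof.
  intros Hab H Hf. apply (Cmod_CInt_le f (fun _ => M) a b l); try assumption.
  exact (is_RInt_const a b M).
Qed.

Lemma is_CInt_minus (f g : R -> C) a b (l m : C) :
  is_CInt f a b l -> is_CInt g a b m -> is_CInt (fun t => f t - g t)%C a b (l - m)%C.
Proof. exact (is_RInt_minus (V := C_R_NormedModule) f g a b l m). Qed.

Lemma is_CInt_plus (f g : R -> C) a b (l m : C) :
  is_CInt f a b l -> is_CInt g a b m -> is_CInt (fun t => f t + g t)%C a b (l + m)%C.
Proof. exact (is_RInt_plus (V := C_R_NormedModule) f g a b l m). Qed.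

Lemma is_CInt_ext (f g : R -> C) a b (l : C) :
  a <= b -> (forall t, a <= t <= b -> f t = g t) -> is_CInt f a b l -> is_CInt g a b l.
Proof.
  intros Hab H. apply (is_RInt_ext (V := C_R_NormedModule)).
  rewrite Rmin_left, Rmax_right by lra. intros t Ht. apply H. lra.
Qed.

Lemma is_CInt_uniq (f : R -> C) a b (l m : C) : is_CInt f a b l -> is_CInt f a b m -> l = m.
Proof.
  intros H1 H2. apply (is_RInt_unique (V := C_R_CompleteNormedModule)) in H1, H2.
  congruence.
Qed.

Lemma is_CInt_conj (f : R -> C) a b (l : C) :
  is_CInt f a b l -> is_CInt (fun t => Cconj (f t)) a b (Cconj l).
Proof.
  intros H. apply is_CInt_components in H. destruct H as [H1 H2].
  apply is_CInt_components. split; [exact H1|].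
  exact (is_RInt_opp (V := R_NormedModule) _ _ _ _ H2).
Qed.

(** The derivatives are explicit functions, so that the notion is visibly stable
    under reflection in the real axis. *)
Definition analytic_tower (f f1 f2 : C -> C) : Prop :=
  forall z, 0 <= fst z -> holo f f1 z /\ holo f1 f2 z.

Lemma upper_algebra (b t l r tk rk FNY F0Y FNe : C) :
  (b + Ci * r - t - Ci * l = 0)%C -> (FNY - F0Y = t + tk)%C ->
  (FNY - FNe = Ci * (r + rk))%C ->
  (b - FNe - Ci * l = Ci * rk - tk - F0Y)%C.
Proof.
  intros H E1 E2.
  replace (b - FNe - Ci * l)%C
    with ((b + Ci * r - t - Ci * l) + t - Ci * r - FNe)%C by ring.
  rewrite H.
  replace t with ((t + tk) - tk)%C by ring. rewrite <- E1.
  replace (Ci * r)%C with (Ci * (r + rk) - Ci * rk)%C by ring. rewrite <- E2.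
  ring.
Qed.

Section Upper.

Variables (p : R) (f f1 f2 : C -> C) (N : nat) (e Y : R).
Hypotheses (Hp : 0 < p) (HN : p <= INR N) (He : 0 < e) (HeY : e <= Y)
  (Hf : analytic_tower f f1 f2).

Let h z := (f1 z * log_kernel p z)%C.
Let k z := (f z * dlog_kernel p z)%C.
Let F z := (f z * log_kernel p z)%C.

Lemma holo_log_kernel_upper z : 0 < snd z -> holo (log_kernel p) (dlog_kernel p) z.
Proof.
  intros Hz. apply holo_log_kernel; [lra|]. destruct z as [x y]. now apply fst_kernel_lt1.
Qed.

Lemma cont2_mult_log_kernel z : 0 <= fst z -> 0 < snd z -> cont2 h z.
Proof.
  intros Hx Hy. apply cont2_mult; [apply (Hf z Hx) | now apply holo_log_kernel_upper].
Qed.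

Lemma cont2_mult_dlog_kernel z : 0 <= fst z -> 0 < snd z -> cont2 k z.
Proof.
  intros Hx Hy. apply cont2_mult; [apply (Hf z Hx) | now apply holo_log_kernel_upper].
Qed.

Lemma cdiff_mult_log_kernel z : 0 <= fst z -> 0 < snd z -> cdiff F z (h z + k z)%C.
Proof.
  intros Hx Hy. apply cdiff_mult; apply holo_cdiff; [apply (Hf z Hx) | now apply holo_log_kernel_upper].
Qed.

(** Cauchy's theorem for [f' log(1 - g)] on the rectangle with corners [i e] and
    [N + i Y]; on the right and on the top side [f'] is integrated by parts,
    since only [f] is controlled there. *)
Lemma upper_identity :
  (CInt (fun x => f1 (x, e) * log_kernel p (x, e)) 0 (INR N)
   - f (INR N, e) * log_kernel p (INR N, e)
   - Ci * CInt (fun t => f1 (0, t) * log_kernel p (0, t)) e Y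
   = Ci * CInt (fun y => f (INR N, y) * dlog_kernel p (INR N, y)) e Y
     - CInt (fun x => f (x, Y) * dlog_kernel p (x, Y)) 0 (INR N)
     - f (0, Y) * log_kernel p (0, Y))%C.
Proof.
  assert (HN0 : 0 <= INR N) by lra.
  assert (CH : forall (q : C -> C) y, 0 < y ->
     (forall z, 0 <= fst z -> 0 < snd z -> cont2 q z) ->
     is_CInt (fun x => q (x, y)) 0 (INR N) (CInt (fun x => q (x, y)) 0 (INR N))).
  { intros q y Hy Hq. apply ex_CInt_cont; [exact HN0|].
    intros x Hx. apply cont2_horizontal, Hq; simpl; lra. }
  assert (CV : forall (q : C -> C) x, 0 <= x ->
     (forall z, 0 <= fst z -> 0 < snd z -> cont2 q z) ->
     is_CInt (fun y => q (x, y)) e Y (CInt (fun y => q (x, y)) e Y)).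
  { intros q x Hx Hq. apply ex_CInt_cont; [exact HeY|].
    intros y Hy. apply cont2_vertical, Hq; simpl; lra. }
  assert (B := CH h e He cont2_mult_log_kernel).
  assert (T := CH h Y ltac:(lra) cont2_mult_log_kernel).
  assert (Le := CV h 0 (Rle_refl 0) cont2_mult_log_kernel).
  assert (Ri := CV h (INR N) HN0 cont2_mult_log_kernel).
  assert (Tk := CH k Y ltac:(lra) cont2_mult_dlog_kernel).
  assert (Rk := CV k (INR N) HN0 cont2_mult_dlog_kernel).
  assert (Cau := cauchy_rectangle h (fun z => f2 z * log_kernel p z + f1 z * dlog_kernel p z)%C
     0 (INR N) e Y _ _ _ _ HN0 HeY
     (fun x y Hx Hy => holo_mult _ _ _ _ (x, y)
        (proj2 (Hf (x, y) (proj1 Hx)))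
        (holo_log_kernel_upper (x, y) (Rlt_le_trans _ _ _ He (proj1 Hy)))) B T Le Ri).
  assert (E1 : (F (INR N, Y) - F (0, Y) =
     CInt (fun x => h (x, Y)) 0 (INR N) + CInt (fun x => k (x, Y)) 0 (INR N))%C).
  { refine (is_CInt_uniq _ _ _ _ _ _ (is_CInt_plus _ _ _ _ _ _ T Tk)).
    apply (cder_is_CInt (fun x => F (x, Y))); [exact HN0 | |].
    - intros x Hx. apply cdiff_horizontal, cdiff_mult_log_kernel; simpl; lra.
    - intros x Hx. apply (cont2_horizontal (fun z => h z + k z)%C).
      apply cont2_plus; [apply cont2_mult_log_kernel | apply cont2_mult_dlog_kernel]; simpl; lra. }
  assert (E2 : (F (INR N, Y) - F (INR N, e) =
     Ci * (CInt (fun y => h (INR N, y)) e Y + CInt (fun y => k (INR N, y)) e Y))%C).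
  { refine (is_CInt_uniq _ _ _ _ _ _ (is_CInt_mult Ci _ _ _ _ (is_CInt_plus _ _ _ _ _ _ Ri Rk))).
    apply (cder_is_CInt (fun y => F (INR N, y))); [exact HeY | |].
    - intros y Hy. apply cdiff_vertical, cdiff_mult_log_kernel; simpl; lra.
    - intros y Hy. apply (cont2_vertical (fun z => Ci * (h z + k z))%C).
      apply cont2_mult; [apply cont2_const|].
      apply cont2_plus; [apply cont2_mult_log_kernel | apply cont2_mult_dlog_kernel]; simpl; lra. }
  fold (h (0, e)). change (f (INR N, e) * log_kernel p (INR N, e))%C with (F (INR N, e)).
  change (f (0, Y) * log_kernel p (0, Y))%C with (F (0, Y)).
  change (fun x => f1 (x, e) * log_kernel p (x, e))%C with (fun x => h (x, e)).
  change (fun t => f1 (0, t) * log_kernel p (0, t))%C with (fun t => h (0, t)).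
  change (fun y => f (INR N, y) * dlog_kernel p (INR N, y))%C with (fun y => k (INR N, y)).
  change (fun x => f (x, Y) * dlog_kernel p (x, Y))%C with (fun x => k (x, Y)).
  exact (upper_algebra _ _ _ _ _ _ _ _ _ Cau E1 E2).
Qed.

End Upper.

Lemma exp_neg_2PI_le_half Y : 1 <= Y -> exp (- (2 * PI * Y)) <= 1 / 2.
Proof.
  intros HY. pose proof PI2_3_2. 
  rewrite exp_Ropp. replace (1 / 2) with (/ 2) by field.
  apply Rinv_le_contravar; [lra|].
  pose proof (exp_ineq1_le (2 * PI * Y)). nra.
Qed.

(** The number [m] measures the right side and [eta] the top side; neither bound
degenerates as [e] tends to [0]. *)
Lemma upper_bound p f f1 f2 N e Y eta m :
  0 < p -> p <= INR N -> 0 < e -> e <= Y -> 1 <= Y -> analytic_tower f f1 f2 ->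
  (forall x, 0 <= x <= INR N -> Cmod (f (x, Y)) * exp (- (2 * PI * Y)) <= eta) ->
  is_RInt (fun y => exp (- (2 * PI * y)) * Cmod (f (INR N, y))) e Y m ->
  Cmod (CInt (fun x => f1 (x, e) * log_kernel p (x, e))%C 0 (INR N)
   - f (INR N, e) * log_kernel p (INR N, e)
   - Ci * CInt (fun t => f1 (0, t) * log_kernel p (0, t))%C e Y)
  <= (2 * PI + 2 / p) * m + (2 * (2 * PI + 2 / p) * INR N + 6) * eta.
Proof.
  intros Hp HN He HeY HY Hf Heta Hm.
  rewrite (upper_identity p f f1 f2 N e Y) by assumption.
  set (C0 := 2 * PI + 2 / p).
  assert (HC0 : 0 < C0).
  { unfold C0. pose proof PI_RGT_0. assert (0 < 2 / p) by (apply Rdiv_lt_0_compat; lra). lra. }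
  pose proof (exp_neg_2PI_le_half Y HY) as Hhalf.
  assert (HN0 : 0 <= INR N) by lra.
  assert (HY0 : 0 < Y) by lra.
  assert (Hk : forall z, 0 <= fst z -> 0 < snd z -> cont2 (fun z => f z * dlog_kernel p z)%C z).
  { exact (fun z => cont2_mult_dlog_kernel p f f1 f2 Hp Hf z). }
  assert (B1 : Cmod (CInt (fun y => f (INR N, y) * dlog_kernel p (INR N, y))%C e Y) <= C0 * m).
  { apply (Cmod_CInt_le (fun y => f (INR N, y) * dlog_kernel p (INR N, y))%C
      (fun y => C0 * (exp (- (2 * PI * y)) * Cmod (f (INR N, y)))) e Y _ _ HeY).
    - intros y Hy. rewrite Cmod_mult.
      destruct (Cmod_one_minus_kernel_integer p N y Hp HN) as [_ H1]; [lra|].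
      pose proof (Cmod_dlog_kernel_le p (INR N) y 1 Hp ltac:(lra) Rlt_0_1 H1) as H2.
      fold C0 in H2. replace (C0 / 1) with C0 in H2 by field.
      pose proof (Cmod_ge_0 (f (INR N, y))). nra.
    - apply ex_CInt_cont; [exact HeY|]. intros y Hy.
      apply (cont2_vertical (fun z => f z * dlog_kernel p z)%C), Hk; simpl; lra.
    - exact (is_RInt_scal (V := R_NormedModule) _ e Y C0 m Hm). }
  assert (B2 : Cmod (CInt (fun x => f (x, Y) * dlog_kernel p (x, Y))%C 0 (INR N))
               <= (INR N - 0) * (2 * C0 * eta)).
  { apply (Cmod_CInt_le_const (fun x => f (x, Y) * dlog_kernel p (x, Y))%C _ 0 (INR N) _ HN0).
    - intros x Hx. rewrite Cmod_mult.
      assert (H1 : 1 / 2 <= Cmod (1 - kernel p (x, Y))).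
      { eapply Rle_trans; [|apply Cmod_one_minus_ge].
        pose proof (Cmod_kernel_le p x Y Hp ltac:(lra)). lra. }
      pose proof (Cmod_dlog_kernel_le p x Y (1 / 2) Hp ltac:(lra) ltac:(lra) H1) as H2.
      fold C0 in H2. replace (C0 / (1 / 2)) with (2 * C0) in H2 by field.
      pose proof (Cmod_ge_0 (f (x, Y))) as H3. pose proof (Heta x Hx) as H4.
      apply Rle_trans with (Cmod (f (x, Y)) * (2 * C0 * exp (- (2 * PI * Y))));
        [now apply Rmult_le_compat_l|].
      replace (Cmod (f (x, Y)) * (2 * C0 * exp (- (2 * PI * Y))))
        with (2 * C0 * (Cmod (f (x, Y)) * exp (- (2 * PI * Y)))) by ring.
      apply Rmult_le_compat_l; lra.
    - apply ex_CInt_cont; [exact HN0|]. intros x Hx.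
      apply (cont2_horizontal (fun z => f z * dlog_kernel p z)%C), Hk; simpl; lra. }
  assert (B3 : Cmod (f (0, Y) * log_kernel p (0, Y)) <= 6 * eta).
  { rewrite Cmod_mult.
    pose proof (Cmod_kernel_le p 0 Y Hp ltac:(lra)) as HG.
    assert (H1 : Cmod (log_kernel p (0, Y)) <= 6 * Cmod (kernel p (0, Y))) by (apply Clog_small; lra).
    pose proof (Heta 0 ltac:(lra)). pose proof (Cmod_ge_0 (f (0, Y))). nra. }
  unfold Cminus. eapply Rle_trans; [apply Cmod_triangle|].
  eapply Rle_trans; [apply Rplus_le_compat_r, Cmod_triangle|].
  rewrite !Cmod_opp, Cmod_mult, Cmod_Ci. lra.
Qed.

(** ** Reflection in the real axis *)

Definition star (f : C -> C) (z : C) : C := Cconj (f (Cconj z)).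

Lemma cder_conj phi t d : cder phi t d -> cder (fun t => Cconj (phi t)) t (Cconj d).
Proof.
  intros [H1 H2]. split; [exact H1 | exact (is_derive_opp _ _ _ H2)].
Qed.

Lemma cdiff_star f z l : cdiff f (Cconj z) l -> cdiff (star f) z (Cconj l).
Proof.
  intros H zeta t d E Hd.
  assert (K := H (fun t => Cconj (zeta t)) t (Cconj d) (f_equal Cconj E) (cder_conj _ _ _ Hd)).
  apply cder_conj in K. eapply cder_eq; [exact K|].
  rewrite Cmult_conj, Cconj_conj. reflexivity.
Qed.

Lemma locally_2d_reflect (P : R -> R -> Prop) x y :
  locally_2d P x (- y) -> locally_2d (fun u v => P u (- v)) x y.
Proof.
  intros [d Hd]. exists d. intros u v Hu Hv. apply Hd; [exact Hu|].
  replace (- v - - y) with (- (v - y)) by ring. now rewrite Rabs_Ropp.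
Qed.

Lemma cont2_star f z : cont2 f (Cconj z) -> cont2 (star f) z.
Proof.
  destruct z as [x y]. intros [H1 H2]. split.
  - intros eps. exact (locally_2d_reflect _ _ _ (H1 eps)).
  - apply continuity_2d_pt_opp. intros eps. exact (locally_2d_reflect _ _ _ (H2 eps)).
Qed.

Lemma analytic_tower_star f f1 f2 : analytic_tower f f1 f2 -> analytic_tower (star f) (star f1) (star f2).
Proof.
  assert (H : forall g d z, holo g d (Cconj z) -> holo (star g) (star d) z).
  { intros g d [x y] (H1 & H2 & H3). split; [|split; now apply cont2_star].
    apply locally_2d_reflect in H1. refine (locally_2d_impl _ _ _ _ _ H1).
    apply locally_2d_forall. intros u v K. now apply cdiff_star. }
  intros Hf z Hz. destruct (Hf (Cconj z) Hz). split; now apply H.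
Qed.

(** The bottom sides of the upper and of the lower rectangle, with the boundary
terms that the integration by parts leaves at the corners [N + i e], [N - i e]. *)
Definition bottom p (f f1 : C -> C) (N : nat) (e : R) : C :=
  (CInt (fun x => f1 (x, e) * log_kernel p (x, e)
     - f1 (x, (- e)%R) * Cconj (log_kernel p (x, e)))%C 0 (INR N)
   - (f (INR N, e) * log_kernel p (INR N, e) - f (INR N, (- e)%R) * Cconj (log_kernel p (INR N, e))))%C.

(** The left sides, on the imaginary axis. *)
Definition side p (f1 : C -> C) (e Y : R) : C :=
  CInt (fun t => (f1 (0, t) + f1 (0, (- t)%R)) * log_kernel p (0, t))%C e Y.

Lemma is_CInt_side p f f1 f2 e Y :
  0 < p -> analytic_tower f f1 f2 -> 0 < e -> e <= Y ->
  is_CInt (fun t => (f1 (0, t) + f1 (0, (- t)%R)) * log_kernel p (0, t))%C e Y (side p f1 e Y).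
Proof.
  intros Hp Hf He HeY. apply ex_CInt_cont; [exact HeY|]. intros t Ht.
  apply (cont2_vertical (fun z => (f1 z + f1 (Cconj z)) * log_kernel p z)%C).
  apply cont2_mult; [|apply (holo_log_kernel_upper p Hp); simpl; lra].
  apply cont2_plus; [apply (Hf (0, t)); simpl; lra|].
  destruct (Hf (0, - t)) as [(_ & _ & [H1 H2]) _]; [simpl; lra|].
  split; intros eps.
  - exact (locally_2d_reflect _ _ _ (H1 eps)).
  - exact (locally_2d_reflect _ _ _ (H2 eps)).
Qed.

(** The lower half-plane is treated by conjugating the upper bound for the reflected
function; on the imaginary axis the logarithm is real, hence the plus sign in
[side]. *)
Lemma contour_bound p f f1 f2 N e Y eta m m' :
  0 < p -> p <= INR N -> 0 < e -> e <= Y -> 1 <= Y -> analytic_tower f f1 f2 ->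
  (forall x, 0 <= x <= INR N ->
     Cmod (f (x, Y)) * exp (- (2 * PI * Y)) <= eta /\
     Cmod (f (x, - Y)) * exp (- (2 * PI * Y)) <= eta) ->
  is_RInt (fun y => exp (- (2 * PI * y)) * Cmod (f (INR N, y))) e Y m ->
  is_RInt (fun y => exp (- (2 * PI * y)) * Cmod (f (INR N, - y))) e Y m' ->
  Cmod (bottom p f f1 N e - Ci * side p f1 e Y)
  <= (2 * PI + 2 / p) * (m + m') + 2 * (2 * (2 * PI + 2 / p) * INR N + 6) * eta.
Proof.
  intros Hp HN He HeY HY Hf Heta Hm Hm'.
  assert (U := upper_bound p f f1 f2 N e Y eta m Hp HN He HeY HY Hf
     (fun x Hx => proj1 (Heta x Hx)) Hm).
  assert (Hs := analytic_tower_star _ _ _ Hf).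
  assert (Hc : forall z, Cmod (Cconj z) = Cmod z) by exact Cmod_conj.
  assert (V := upper_bound p (star f) (star f1) (star f2) N e Y eta m' Hp HN He HeY HY Hs).
  assert (V' := V ltac:(intros x Hx; unfold star; rewrite Hc; exact (proj2 (Heta x Hx)))
     ltac:(refine (is_RInt_ext _ _ _ _ _ _ Hm'); intros y _; unfold star; now rewrite Hc)).
  clear V.
  assert (HN0 : 0 <= INR N) by lra.
  assert (Bot : forall g g1 g2, analytic_tower g g1 g2 ->
    is_CInt (fun x => g1 (x, e) * log_kernel p (x, e))%C 0 (INR N)
     (CInt (fun x => g1 (x, e) * log_kernel p (x, e))%C 0 (INR N))).
  { intros g g1 g2 Hg. apply ex_CInt_cont; [exact HN0|]. intros x Hx.
    apply (cont2_horizontal (fun z => g1 z * log_kernel p z)%C).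
    apply (cont2_mult_log_kernel p g g1 g2 Hp Hg); simpl; lra. }
  assert (Sid : forall g g1 g2, analytic_tower g g1 g2 ->
    is_CInt (fun t => g1 (0, t) * log_kernel p (0, t))%C e Y
     (CInt (fun t => g1 (0, t) * log_kernel p (0, t))%C e Y)).
  { intros g g1 g2 Hg. apply ex_CInt_cont; [exact HeY|]. intros t Ht.
    apply (cont2_vertical (fun z => g1 z * log_kernel p z)%C).
    apply (cont2_mult_log_kernel p g g1 g2 Hp Hg); simpl; lra. }
  assert (B1 := Bot _ _ _ Hf). assert (B2 := is_CInt_conj _ _ _ _ (Bot _ _ _ Hs)).
  assert (S1 := Sid _ _ _ Hf). assert (S2 := is_CInt_conj _ _ _ _ (Sid _ _ _ Hs)).
  rewrite <- Cmod_conj in V'.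
  set (b1 := CInt (fun x => f1 (x, e) * log_kernel p (x, e))%C 0 (INR N)) in *.
  set (b2 := CInt (fun x => star f1 (x, e) * log_kernel p (x, e))%C 0 (INR N)) in *.
  set (s1 := CInt (fun t => f1 (0, t) * log_kernel p (0, t))%C e Y) in *.
  set (s2 := CInt (fun t => star f1 (0, t) * log_kernel p (0, t))%C e Y) in *.
  assert (Eb : CInt (fun x => f1 (x, e) * log_kernel p (x, e)
    - f1 (x, (- e)%R) * Cconj (log_kernel p (x, e)))%C 0 (INR N)
     = (b1 - Cconj b2)%C).
  { refine (is_RInt_unique (V := C_R_CompleteNormedModule) _ _ _ _ (is_CInt_minus _ _ _ _ _ _ B1 _)).
    refine (is_CInt_ext _ _ _ _ _ HN0 _ B2). intros x Hx.
    unfold star. rewrite Cmult_conj, Cconj_conj. reflexivity. }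
  assert (Es : side p f1 e Y = (s1 + Cconj s2)%C).
  { refine (is_RInt_unique (V := C_R_CompleteNormedModule) _ _ _ _ _).
    refine (is_CInt_ext _ _ _ _ _ HeY _ (is_CInt_plus _ _ _ _ _ _ S1 S2)). intros t Ht.
    unfold star. rewrite Cmult_conj, Cconj_conj, log_kernel_vertical by lra.
    replace (Cconj (RtoC (ln (1 - sigma_ratio p (- t) * exp (- (2 * PI * t))))))
      with (RtoC (ln (1 - sigma_ratio p (- t) * exp (- (2 * PI * t)))))
      by (apply injective_projections; simpl; ring).
    rewrite Cmult_plus_distr_r. reflexivity. }
  unfold bottom. rewrite Eb, Es.
  set (A1 := (b1 - f (INR N, e) * log_kernel p (INR N, e) - Ci * s1)%C) in *.
  set (A2 := (b2 - star f (INR N, e) * log_kernel p (INR N, e) - Ci * s2)%C) in *.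
  replace (_ - _)%C with (A1 + - Cconj A2)%C.
  - eapply Rle_trans; [apply Cmod_triangle|]. rewrite Cmod_opp. lra.
  - unfold A1, A2. rewrite !Cminus_conj, !Cmult_conj. unfold star at 1. rewrite Cconj_conj.
    replace (Cconj Ci) with (- Ci)%C by (apply injective_projections; simpl; ring).
    change (Cconj (INR N, e)) with ((INR N, (- e)%R) : C). ring.
Qed.

(** * The limit on the real axis *)

(** The limit as the height [e] of the contour above the real axis tends to [0]. *)
Definition lim0 (F : R -> C) (l : C) : Prop :=
  forall eta, 0 < eta -> exists d, 0 < d /\
    forall e, 0 < e < d -> Cmod (F e - l) < eta.

Lemma lim0_ext F F' l d :
  0 < d -> (forall e, 0 < e < d -> F e = F' e) -> lim0 F l -> lim0 F' l.
Proof.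
  intros Hd H HF eta Heta. destruct (HF eta Heta) as (d' & Hd' & K).
  exists (Rmin d d'). split; [now apply Rmin_pos|].
  intros e He. pose proof (Rmin_l d d'). pose proof (Rmin_r d d').
  rewrite <- H by lra. apply K. lra.
Qed.

Lemma lim0_const c : lim0 (fun _ => c) c.
Proof.
  intros eta Heta. exists 1. split; [lra|]. intros e _.
  replace (c - c)%C with (RtoC 0) by ring. now rewrite Cmod_0.
Qed.

Lemma lim0_plus F F' l l' : lim0 F l -> lim0 F' l' -> lim0 (fun e => F e + F' e)%C (l + l')%C.
Proof.
  intros H H' eta Heta.
  destruct (H (eta / 2) ltac:(lra)) as (d & Hd & K).
  destruct (H' (eta / 2) ltac:(lra)) as (d' & Hd' & K').
  exists (Rmin d d'). split; [now apply Rmin_pos|].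
  intros e He. pose proof (Rmin_l d d'). pose proof (Rmin_r d d').
  replace (F e + F' e - (l + l'))%C with ((F e - l) + (F' e - l'))%C by ring.
  eapply Rle_lt_trans; [apply Cmod_triangle|].
  specialize (K e ltac:(lra)). specialize (K' e ltac:(lra)). lra.
Qed.

Lemma lim0_mult c F l : lim0 F l -> lim0 (fun e => c * F e)%C (c * l)%C.
Proof.
  intros H eta Heta. pose proof (Cmod_ge_0 c) as Hc.
  destruct (H (eta / (Cmod c + 1)) ltac:(apply Rdiv_lt_0_compat; lra)) as (d & Hd & K).
  exists d. split; [exact Hd|]. intros e He. specialize (K e He).
  replace (c * F e - c * l)%C with (c * (F e - l))%C by ring. rewrite Cmod_mult.
  pose proof (Cmod_ge_0 (F e - l)) as H0.
  assert (Cmod (F e - l) * (Cmod c + 1) < eta).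
  { apply Rlt_le_trans with (eta / (Cmod c + 1) * (Cmod c + 1)).
    - apply Rmult_lt_compat_r; lra.
    - right. field. lra. }
  nra.
Qed.

Lemma lim0_minus F F' l l' : lim0 F l -> lim0 F' l' -> lim0 (fun e => F e - F' e)%C (l - l')%C.
Proof.
  intros H H'. apply (lim0_ext (fun e => F e + - (1) * F' e)%C _ _ 1 Rlt_0_1); [intros; ring|].
  replace (l - l')%C with (l + - (1) * l')%C by ring.
  apply lim0_plus; [exact H | now apply lim0_mult].
Qed.

(** The error made by freezing [f'] at height [0] is of this size, because
    [log(1 - g)] is only logarithmically singular. *)
Lemma lim0_small F M d :
  0 < d -> (forall e, 0 < e < d -> Cmod (F e) <= M * (e * (4 + 2 / sqrt e))) -> lim0 F 0%C.
Proof.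
  intros Hd H eta Heta.
  set (K := Rabs M + 1). assert (HK : 0 < K) by (unfold K; pose proof (Rabs_pos M); lra).
  (* With [r = sqrt e], the bound is [r * (4 r + 2) <= 6 r] for [r <= 1]. *)
  set (q := Rmin 1 (eta / (7 * K))).
  assert (Hq : 0 < q) by (apply Rmin_pos; [lra | apply Rdiv_lt_0_compat; lra]).
  exists (Rmin d (q * q)). split; [apply Rmin_pos; nra|]. intros e He.
  pose proof (Rmin_l d (q * q)). pose proof (Rmin_r d (q * q)).
  replace (F e - 0)%C with (F e) by ring.
  eapply Rle_lt_trans; [apply H; lra|].
  set (r := sqrt e). assert (Hr : 0 < r) by (apply sqrt_lt_R0; lra).
  assert (Er : r * r = e) by (apply sqrt_sqrt; lra).
  assert (Hrq : r < q) by nra.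
  assert (Hq1 : q <= 1) by apply Rmin_l. assert (Hq2 : q <= eta / (7 * K)) by apply Rmin_r.
  replace (e * (4 + 2 / r)) with (r * (4 * r + 2)) by (rewrite <- Er; field; lra).
  assert (0 < r * (4 * r + 2)) by nra.
  apply Rle_lt_trans with (K * (r * (4 * r + 2))).
  { apply Rmult_le_compat_r; [lra|]. unfold K. pose proof (Rle_abs M). lra. }
  apply Rle_lt_trans with (K * (6 * q)); [apply Rmult_le_compat_l; nra|].
  apply Rle_lt_trans with (K * (6 * (eta / (7 * K)))); [nra|].
  replace (K * (6 * (eta / (7 * K)))) with (6 / 7 * eta) by (field; lra). lra.
Qed.

Lemma lim0_cont2 q x : cont2 q (x, 0) -> lim0 (fun e => q (x, e)) (q (x, 0)).
Proof.
  intros [H1 H2] eta Heta. cbn [fst snd] in H1, H2.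
  assert (Hh : 0 < eta / 2) by lra.
  destruct (H1 (mkposreal _ Hh)) as [d1 K1]. destruct (H2 (mkposreal _ Hh)) as [d2 K2].
  exists (Rmin d1 d2). split; [apply Rmin_pos; apply cond_pos|]. intros e He.
  pose proof (Rmin_l d1 d2). pose proof (Rmin_r d1 d2).
  assert (Hx : forall d, 0 < d -> Rabs (x - x) < d).
  { intros d Hd. rewrite Rminus_diag, Rabs_R0. exact Hd. }
  assert (He' : Rabs (e - 0) = e) by (rewrite Rminus_0_r; apply Rabs_pos_eq; lra).
  specialize (K1 x e (Hx _ (cond_pos _)) ltac:(lra)).
  specialize (K2 x e (Hx _ (cond_pos _)) ltac:(lra)).
  eapply Rle_lt_trans; [apply Cmod_le_Rabs|].
  simpl pos in K1, K2.
  change (Rabs (fst (q (x, e)) - fst (q (x, 0))) + Rabs (snd (q (x, e)) - snd (q (x, 0))) < eta).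
  lra.
Qed.

Lemma is_CInt_Chasles (f : R -> C) a b c (l m : C) :
  is_CInt f a b l -> is_CInt f b c m -> is_CInt f a c (l + m)%C.
Proof. exact (is_RInt_Chasles (V := C_R_NormedModule) f a b c l m). Qed.

Lemma continuous_mult_RtoC (phi : R -> C) (s : R -> R) t :
  @continuous R_UniformSpace C_R_NormedModule phi t -> continuous s t ->
  @continuous R_UniformSpace C_R_NormedModule (fun t => phi t * RtoC (s t))%C t.
Proof.
  intros H1 H2.
  apply (continuous_ext (fun t => scal (s t) (phi t : C_R_NormedModule))).
  - intros x. apply injective_projections; simpl; unfold scal; simpl; unfold mult; simpl; ring.
  - exact (continuous_scal (K := R_AbsRing) (V := C_R_NormedModule) s phi t H2 H1).
Qed.

(** Bounded convergence: [s x e] tends to [S x] locally uniformly inside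
    [a, b] and stays bounded near the end points. *)
Lemma bounded_convergence (phi : R -> C) (s : R -> R -> R) (S : R -> R) a b :
  a < b ->
  (forall x, a <= x <= b -> @continuous R_UniformSpace C_R_NormedModule phi x) ->
  (forall x, a <= x <= b -> continuous S x) ->
  (forall x, a <= x <= b -> Rabs (S x) <= 2) ->
  (forall x, a < x < b -> continuity_2d_pt s x 0 /\ s x 0 = S x) ->
  (forall x e, Rabs (s x e) <= 2) ->
  (forall x e, 0 < e -> a <= x <= b -> continuous (fun x => s x e) x) ->
  lim0 (fun e => CInt (fun x => phi x * RtoC (s x e))%C a b)
       (CInt (fun x => phi x * RtoC (S x))%C a b).
Proof.
  intros Hab Hphi HS HSb Hs Hsb Hsc eta Heta.
  destruct (bounded_continuity (V := C_R_NormedModule) phi a b Hphi) as [M HM].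
  assert (HM' : forall x, a <= x <= b -> Cmod (phi x) < M).
  { intros x Hx. rewrite <- norm_C. now apply HM. }
  assert (HM0 : 0 < M).
  { eapply Rle_lt_trans; [apply Cmod_ge_0 | apply (HM' a); lra]. }
  (* The integrand is at most [4 M] on the two end pieces of length [delta]. *)
  set (delta := Rmin ((b - a) / 4) (eta / (32 * M))).
  assert (Hd : 0 < delta) by (apply Rmin_pos; apply Rdiv_lt_0_compat; lra).
  assert (Hd1 : delta <= (b - a) / 4) by apply Rmin_l.
  assert (Hd2 : delta <= eta / (32 * M)) by apply Rmin_r.
  assert (Heta' : 0 < eta / (4 * M * (b - a))) by (apply Rdiv_lt_0_compat; nra).
  destruct (uniform_continuity_2d_1d s (a + delta) (b - delta) 0
     (fun x Hx => proj1 (Hs x ltac:(lra))) (mkposreal _ Heta')) as [d Hdu].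
  exists d. split; [apply cond_pos|]. intros e He.
  set (g := fun x => (phi x * RtoC (s x e - S x))%C).
  assert (Hgc : forall x, a <= x <= b -> @continuous R_UniformSpace C_R_NormedModule g x).
  { intros x Hx. apply continuous_mult_RtoC; [now apply Hphi|].
    apply (continuous_minus (V := R_NormedModule)); [now apply Hsc | now apply HS]. }
  assert (Hgb : forall x, a <= x <= b -> Cmod (g x) <= 4 * M).
  { intros x Hx. unfold g. rewrite Cmod_mult, Cmod_R.
    assert (Rabs (s x e - S x) <= 4).
    { unfold Rminus. eapply Rle_trans; [apply Rabs_triang|]. rewrite Rabs_Ropp.
      pose proof (Hsb x e). pose proof (HSb x Hx). lra. }
    pose proof (HM' x Hx). pose proof (Cmod_ge_0 (phi x)).
    pose proof (Rabs_pos (s x e - S x)). nra. }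
  assert (I1 := ex_CInt_cont g a (a + delta) ltac:(lra) (fun x Hx => Hgc x ltac:(lra))).
  assert (I2 := ex_CInt_cont g (a + delta) (b - delta) ltac:(lra) (fun x Hx => Hgc x ltac:(lra))).
  assert (I3 := ex_CInt_cont g (b - delta) b ltac:(lra) (fun x Hx => Hgc x ltac:(lra))).
  assert (B1 := Cmod_CInt_le_const g (4 * M) a (a + delta) _ ltac:(lra) (fun x Hx => Hgb x ltac:(lra)) I1).
  assert (B3 := Cmod_CInt_le_const g (4 * M) (b - delta) b _ ltac:(lra) (fun x Hx => Hgb x ltac:(lra)) I3).
  assert (B2 := Cmod_CInt_le_const g (M * (eta / (4 * M * (b - a)))) (a + delta) (b - delta) _ ltac:(lra)
     ltac:(intros x Hx; unfold g; rewrite Cmod_mult, Cmod_R;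
       destruct (Hs x ltac:(lra)) as [_ <-];
       apply Rmult_le_compat; [apply Cmod_ge_0 | apply Rabs_pos | left; apply HM'; lra |];
       left; apply Hdu; try lra; rewrite Rminus_diag, Rabs_R0; apply cond_pos) I2).
  assert (I := is_CInt_Chasles _ _ _ _ _ _ (is_CInt_Chasles _ _ _ _ _ _ I1 I2) I3).
  assert (J1 := ex_CInt_cont (fun x => phi x * RtoC (s x e))%C a b ltac:(lra)
    (fun x Hx => continuous_mult_RtoC phi _ x (Hphi x Hx) (Hsc x e ltac:(lra) Hx))).
  assert (J2 := ex_CInt_cont (fun x => phi x * RtoC (S x))%C a b ltac:(lra)
    (fun x Hx => continuous_mult_RtoC phi _ x (Hphi x Hx) (HS x Hx))).
  assert (J := is_CInt_minus _ _ _ _ _ _ J1 J2).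
  assert (J' := is_CInt_ext (fun x => phi x * RtoC (s x e) - phi x * RtoC (S x))%C g a b _
     ltac:(lra) ltac:(intros x _; unfold g; rewrite RtoC_minus; ring) J).
  assert (E := is_CInt_uniq _ _ _ _ _ J' I).
  rewrite E.
  eapply Rle_lt_trans; [apply Cmod_triangle|].
  eapply Rle_lt_trans; [apply Rplus_le_compat_r, Cmod_triangle|].
  assert (K1 : delta * (4 * M) <= eta / 8).
  { apply Rle_trans with (eta / (32 * M) * (4 * M)); [nra|]. right. field. lra. }
  assert (K2 : (b - delta - (a + delta)) * (M * (eta / (4 * M * (b - a)))) <= eta / 4).
  { apply Rle_trans with ((b - a) * (M * (eta / (4 * M * (b - a))))).
    - apply Rmult_le_compat_r; [nra | lra].
    - right. field. lra. }
  replace (a + delta - a) with delta in B1 by ring.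
  replace (b - (b - delta)) with delta in B3 by ring.
  lra.
Qed.

Definition weight (p x : R) : R := (p * (p + 1 / PI) + x ^ 2) / (p ^ 2 + x ^ 2).

Definition weighted_integral p (f : C -> C) a b : C := CInt (fun x => RtoC (weight p x) * f (RtoC x))%C a b.

Lemma continuous_weight p x : 0 < p -> continuous (weight p) x.
Proof.
  intros Hp. apply (ex_derive_continuous (V := R_NormedModule)).
  unfold weight. auto_derive. nra.
Qed.

Lemma analytic_tower_continuous_real f f1 f2 x :
  analytic_tower f f1 f2 -> 0 <= x ->
  @continuous R_UniformSpace C_R_NormedModule (fun x => f (RtoC x)) x /\
  @continuous R_UniformSpace C_R_NormedModule (fun x => f1 (RtoC x)) x.
Proof.
  intros Hf Hx. destruct (Hf (RtoC x) Hx) as [(_ & H1 & H2) _].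
  split; [exact (cont2_horizontal f x 0 H1) | exact (cont2_horizontal f1 x 0 H2)].
Qed.

Lemma is_CInt_weighted p f f1 f2 a b :
  0 < p -> analytic_tower f f1 f2 -> 0 <= a -> a <= b ->
  is_CInt (fun x => RtoC (weight p x) * f (RtoC x))%C a b (weighted_integral p f a b).
Proof.
  intros Hp Hf Ha Hab. apply ex_CInt_cont; [exact Hab|]. intros x Hx.
  apply (continuous_ext (fun x => f (RtoC x) * RtoC (weight p x))%C).
  - intros t. apply Cmult_comm.
  - apply continuous_mult_RtoC; [exact (proj1 (analytic_tower_continuous_real f f1 f2 x Hf ltac:(lra)))|].
    now apply continuous_weight.
Qed.

(** The part of the bottom side that survives in the limit. *)
Definition slice p (f1 : C -> C) a b (e : R) : C :=
  CInt (fun x => f1 (RtoC x) * RtoC (snd (log_kernel p (x, e))))%C a b.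

Lemma continuous_snd_log_kernel p x e : 0 < p -> 0 < e -> continuous (fun x => snd (log_kernel p (x, e))) x.
Proof.
  intros Hp He. destruct (holo_log_kernel_upper p Hp (x, e) He) as (_ & [_ H] & _).
  exact (continuity_2d_pt_continuous_fst _ _ _ H).
Qed.

Lemma is_CInt_slice p f f1 f2 a b e :
  0 < p -> analytic_tower f f1 f2 -> 0 <= a -> a <= b -> 0 < e ->
  is_CInt (fun x => f1 (RtoC x) * RtoC (snd (log_kernel p (x, e))))%C a b (slice p f1 a b e).
Proof.
  intros Hp Hf Ha Hab He. apply ex_CInt_cont; [exact Hab|]. intros x Hx.
  apply continuous_mult_RtoC; [exact (proj2 (analytic_tower_continuous_real f f1 f2 x Hf ltac:(lra)))|].
  now apply continuous_snd_log_kernel.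
Qed.

(** Between consecutive zeros the argument tends boundedly to [branch], and an
    integration by parts with [branch' = pi weight] remains. *)
Lemma slice_limit p f f1 f2 n a b :
  0 < p -> analytic_tower f f1 f2 -> 0 <= a -> a < b ->
  - (PI / 2) <= branch p n a -> branch p n b <= PI / 2 ->
  lim0 (slice p f1 a b)
    (f (RtoC b) * RtoC (branch p n b) - f (RtoC a) * RtoC (branch p n a)
     - RtoC PI * weighted_integral p f a b)%C.
Proof.
  intros Hp Hf Ha Hab Hla Hlb.
  assert (Hal : forall x, a <= x <= b -> - (PI / 2) <= branch p n x <= PI / 2).
  { assert (Hmon : forall x y, x <= y -> branch p n x <= branch p n y).
    { intros x y [H| ->]; [left; now apply branch_increasing | apply Rle_refl]. }
    intros x [Hx Hx']. pose proof (Hmon a x Hx). pose proof (Hmon x b Hx'). lra. }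
  assert (Hpi : PI <= 4) by exact PI_4.
  assert (Hca : forall x, continuous (branch p n) x).
  { intros x. apply (ex_derive_continuous (V := R_NormedModule)).
    eexists. now apply is_derive_branch. }
  assert (Hc1 : forall x, a <= x <= b ->
     @continuous R_UniformSpace C_R_NormedModule (fun x => f1 (RtoC x)) x).
  { intros x Hx. exact (proj2 (analytic_tower_continuous_real f f1 f2 x Hf ltac:(lra))). }
  assert (Hlim := bounded_convergence (fun x => f1 (RtoC x)) (fun x e => snd (log_kernel p (x, e)))
     (branch p n) a b Hab Hc1 (fun x _ => Hca x)).
  assert (E : CInt (fun x => f1 (RtoC x) * RtoC (branch p n x))%C a b =
     (f (RtoC b) * RtoC (branch p n b) - f (RtoC a) * RtoC (branch p n a)
     - RtoC PI * weighted_integral p f a b)%C).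
  { assert (I1 := ex_CInt_cont (fun x => f1 (RtoC x) * RtoC (branch p n x))%C a b ltac:(lra)
      (fun x Hx => continuous_mult_RtoC _ _ x (Hc1 x Hx) (Hca x))).
    assert (I2 := is_CInt_mult (RtoC PI) _ _ _ _ (is_CInt_weighted p f f1 f2 a b Hp Hf Ha ltac:(lra))).
    assert (I := is_CInt_plus _ _ _ _ _ _ I1 I2).
    assert (K : is_CInt (fun x => f1 (RtoC x) * RtoC (branch p n x)
         + RtoC PI * (RtoC (weight p x) * f (RtoC x)))%C a b
       (f (RtoC b) * RtoC (branch p n b) - f (RtoC a) * RtoC (branch p n a))%C).
    { apply (cder_is_CInt (fun x => f (RtoC x) * RtoC (branch p n x))%C); [lra | |].
      - intros x Hx. eapply cder_eq.
        + apply cder_mult.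
          * exact (cdiff_horizontal f x 0 (f1 (x, 0))
              (holo_cdiff f f1 (x, 0) (proj1 (Hf (x, 0) (Rle_trans _ _ _ Ha (proj1 Hx)))))).
          * apply cder_RtoC, is_derive_branch, Hp.
        + fold (weight p x). rewrite RtoC_mult. change ((x, 0) : C) with (RtoC x). ring.
      - intros x Hx. apply (continuous_plus (V := C_R_NormedModule)).
        + apply continuous_mult_RtoC; [now apply Hc1 | apply Hca].
        + apply (continuous_ext (fun x => f (RtoC x) * RtoC (PI * weight p x))%C).
          * intros t. rewrite RtoC_mult.
            change (f (RtoC t) * (RtoC PI * RtoC (weight p t))
              = RtoC PI * (RtoC (weight p t) * f (RtoC t)))%C. ring.
          * apply continuous_mult_RtoC; [exact (proj1 (analytic_tower_continuous_real f f1 f2 x Hf ltac:(lra)))|].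
            apply (continuous_mult (K := R_AbsRing) (fun _ => PI));
              [apply continuous_const | now apply continuous_weight]. }
    rewrite (is_CInt_uniq _ _ _ _ _ K I). 
    assert (alg : forall x y : C, x = (x + y - y)%C) by (intros; ring).
    exact (alg _ _). }
  rewrite <- E. apply Hlim; clear Hlim E.
  - intros x Hx. specialize (Hal x Hx). apply Rabs_le. lra.
  - intros x Hx.
    assert (Hax : - (PI / 2) < branch p n x < PI / 2).
    { pose proof (branch_increasing p n a x Hp ltac:(lra)).
      pose proof (branch_increasing p n x b Hp ltac:(lra)). lra. }
    destruct (snd_log_kernel_real p n x Hp Hax) as [H1 H2]. split; [|exact H2].
    destruct (holo_log_kernel p (x, 0) ltac:(simpl; lra) H1) as (_ & [_ H3] & _). exact H3.
  - intros x e. unfold log_kernel, Clog. cbn [snd].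
    match goal with |- Rabs (atan ?v) <= 2 => pose proof (atan_bound v) end.
    apply Rabs_le. lra.
  - intros x e He _. now apply continuous_snd_log_kernel.
Qed.

Fixpoint sum_upto (u : nat -> C) (n : nat) : C :=
  match n with O => 0%C | S m => (sum_upto u m + u (S m))%C end.

Section Zeros.

Variables (p : R) (mu : nat -> R).
Hypotheses (Hp : 0 < p) (Hmu0 : mu 0%nat = 0)
  (Hmu : forall n, (1 <= n)%nat ->
     INR n - 1 / 2 < mu n < INR n /\ tan (PI * mu n) = - mu n / p).

Lemma zero_angle n : PI * mu n + atan (mu n / p) = PI * INR n.
Proof.
  destruct n as [|n].
  - rewrite Hmu0. unfold Rdiv. rewrite Rmult_0_l, atan_0. simpl. ring.
  - destruct (Hmu (S n)) as [H1 H2]; [lia|]. apply root_angle; try assumption. lia.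
Qed.

Lemma zero_bounds n : 0 <= mu n <= INR n /\ mu n < mu (S n) /\ ((1 <= n)%nat -> mu n < INR n).
Proof.
  assert (H0 : forall n, INR n - 1 / 2 < mu n <= INR n).
  { intros [|k]; [rewrite Hmu0; simpl; lra|].
    destruct (Hmu (S k)) as [H1 _]; [lia | lra]. }
  pose proof (H0 n) as H1. destruct (Hmu (S n)) as [H2 _]; [lia|]. rewrite S_INR in H2.
  split; [|split].
  - split; [|lra]. destruct n as [|k]; [rewrite Hmu0; lra|].
    rewrite S_INR in H1. pose proof (pos_INR k). lra.
  - lra.
  - intros Hn. now destruct (Hmu n Hn).
Qed.

Lemma branch_zero n : branch p n (mu n) = - (PI / 2).
Proof. unfold branch. pose proof (zero_angle n). lra. Qed.

Lemma branch_next_zero n : branch p n (mu (S n)) = PI / 2.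
Proof. unfold branch. pose proof (zero_angle (S n)) as H. rewrite S_INR in H. lra. Qed.

Variables (f f1 f2 : C -> C).
Hypothesis Hf : analytic_tower f f1 f2.

Let u n := f (RtoC (mu n)).

Lemma weighted_integral_Chasles a b c : 0 <= a -> a <= b -> b <= c ->
  (weighted_integral p f a c = weighted_integral p f a b + weighted_integral p f b c)%C.
Proof.
  intros Ha Hab Hbc. refine (is_CInt_uniq _ _ _ _ _ _ (is_CInt_Chasles _ _ _ _ _ _ _ _));
    apply (is_CInt_weighted p f f1 f2); try assumption; lra.
Qed.

Lemma slice_Chasles a b c e : 0 <= a -> a <= b -> b <= c -> 0 < e ->
  (slice p f1 a c e = slice p f1 a b e + slice p f1 b c e)%C.
Proof.
  intros Ha Hab Hbc He. refine (is_CInt_uniq _ _ _ _ _ _ (is_CInt_Chasles _ _ _ _ _ _ _ _));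
    apply (is_CInt_slice p f f1 f2); try assumption; lra.
Qed.

(** Adding up the pieces: at an inner zero the end value [pi / 2] of one branch and
the start value [- pi / 2] of the next one contribute [pi f (mu n)] together; at the
origin and at the last zero only one of them is present. *)
Lemma slice_limit_zeros m :
  lim0 (slice p f1 0 (mu m))
    (RtoC (PI / 2) * f (RtoC 0) + RtoC PI * sum_upto u m - RtoC (PI / 2) * u m
     - RtoC PI * weighted_integral p f 0 (mu m))%C.
Proof.
  induction m as [|m IH].
  - assert (E : forall q : R -> C, CInt q 0 (mu 0%nat) = RtoC 0).
    { intros q. rewrite Hmu0. apply (RInt_point (V := C_R_CompleteNormedModule)). }
    apply (lim0_ext (fun _ => 0%C) _ _ 1 Rlt_0_1).
    { intros e _. symmetry. apply E. }
    unfold weighted_integral. rewrite E. unfold u. rewrite Hmu0. simpl sum_upto.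
    replace (_ - _)%C with (RtoC 0) by ring. apply lim0_const.
  - destruct (zero_bounds m) as (H1 & H2 & _).
    apply (lim0_ext (fun e => slice p f1 0 (mu m) e + slice p f1 (mu m) (mu (S m)) e)%C _ _ 1 Rlt_0_1).
    { intros e He. symmetry. apply slice_Chasles; lra. }
    assert (K := slice_limit p f f1 f2 m (mu m) (mu (S m)) Hp Hf ltac:(lra) H2
       ltac:(rewrite branch_zero; lra) ltac:(rewrite branch_next_zero; lra)).
    assert (K' := lim0_plus _ _ _ _ IH K).
    rewrite branch_zero, branch_next_zero in K'.
    fold (u m) (u (S m)) in K'.
    rewrite (weighted_integral_Chasles 0 (mu m) (mu (S m))) by lra.
    replace (_ - _)%C with
      (RtoC (PI / 2) * f (RtoC 0) + RtoC PI * sum_upto u m - RtoC (PI / 2) * u m -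
       RtoC PI * weighted_integral p f 0 (mu m) +
       (u (S m) * RtoC (PI / 2) - u m * RtoC (- (PI / 2)) -
        RtoC PI * weighted_integral p f (mu m) (mu (S m))))%C; [exact K'|].
    simpl sum_upto. replace (RtoC PI) with (RtoC (PI / 2) + RtoC (PI / 2))%C
      by (rewrite <- RtoC_plus; f_equal; field).
    rewrite RtoC_opp. ring.
Qed.

Lemma slice_limit_integer N : (1 <= N)%nat ->
  lim0 (slice p f1 0 (INR N))
    (RtoC (PI / 2) * f (RtoC 0) + RtoC PI * sum_upto u N
     + f (RtoC (INR N)) * RtoC (branch p N (INR N))
     - RtoC PI * weighted_integral p f 0 (INR N))%C.
Proof.
  intros HN. destruct (zero_bounds N) as (H1 & _ & H2). specialize (H2 HN).
  apply (lim0_ext (fun e => slice p f1 0 (mu N) e + slice p f1 (mu N) (INR N) e)%C _ _ 1 Rlt_0_1).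
  { intros e He. symmetry. apply slice_Chasles; lra. }
  assert (Ha : branch p N (INR N) <= PI / 2).
  { unfold branch. pose proof (atan_bound (INR N / p)). pose proof PI_RGT_0. lra. }
  assert (K := slice_limit p f f1 f2 N (mu N) (INR N) Hp Hf ltac:(lra) H2
       ltac:(rewrite branch_zero; lra) Ha).
  assert (K' := lim0_plus _ _ _ _ (slice_limit_zeros N) K).
  rewrite branch_zero in K'. fold (u N) in K'.
  rewrite (weighted_integral_Chasles 0 (mu N) (INR N)) by lra.
  replace (_ - _)%C with
      (RtoC (PI / 2) * f (RtoC 0) + RtoC PI * sum_upto u N - RtoC (PI / 2) * u N -
       RtoC PI * weighted_integral p f 0 (mu N) +
       (f (RtoC (INR N)) * RtoC (branch p N (INR N)) - u N * RtoC (- (PI / 2)) -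
        RtoC PI * weighted_integral p f (mu N) (INR N)))%C; [exact K'|].
  rewrite RtoC_opp. ring.
Qed.

End Zeros.

(** The second derivative is bounded on a thin strip around [[0, b]], by uniform
    continuity across the real axis. *)
Lemma analytic_tower_lipschitz f f1 f2 b :
  analytic_tower f f1 f2 -> 0 <= b ->
  exists M d, 0 < d /\ forall x e, 0 <= x <= b -> 0 < e < d ->
    Cmod (f1 (x, e) - f1 (x, 0)) <= M * e /\ Cmod (f1 (x, - e) - f1 (x, 0)) <= M * e.
Proof.
  intros Hf Hb.
  assert (Hc : forall x y, 0 <= x -> cont2 f2 (x, y)).
  { intros x y Hx. apply (Hf (x, y) Hx). }
  destruct (uniform_continuity_2d_1d (fun x y => fst (f2 (x, y))) 0 b 0
     (fun x Hx => proj1 (Hc x 0 (proj1 Hx))) (mkposreal 1 Rlt_0_1)) as [d1 H1].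
  destruct (uniform_continuity_2d_1d (fun x y => snd (f2 (x, y))) 0 b 0
     (fun x Hx => proj2 (Hc x 0 (proj1 Hx))) (mkposreal 1 Rlt_0_1)) as [d2 H2].
  destruct (bounded_continuity (V := C_R_NormedModule) (fun x => f2 (x, 0)) 0 b
     (fun x Hx => cont2_horizontal f2 x 0 (Hc x 0 (proj1 Hx)))) as [M HM].
  simpl pos in H1, H2.
  assert (HB : forall x y, 0 <= x <= b -> Rabs y < Rmin d1 d2 -> Cmod (f2 (x, y)) <= M + 2).
  { intros x y Hx Hy. pose proof (Rmin_l d1 d2). pose proof (Rmin_r d1 d2).
    pose proof (cond_pos d1). pose proof (cond_pos d2).
    apply Rabs_def2 in Hy. destruct Hy as [Hy1 Hy2].
    assert (Hxx : forall d : posreal, Rabs (x - x) < d).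
    { intros d. rewrite Rminus_diag, Rabs_R0. apply cond_pos. }
    specialize (H1 x 0 x y Hx ltac:(lra) Hx ltac:(lra) (Hxx d1)).
    specialize (H2 x 0 x y Hx ltac:(lra) Hx ltac:(lra) (Hxx d2)).
    specialize (HM x Hx). rewrite norm_C in HM.
    replace (f2 (x, y)) with (f2 (x, 0) + (f2 (x, y) - f2 (x, 0)))%C by ring.
    eapply Rle_trans; [apply Cmod_triangle|].
    assert (K : Cmod (f2 (x, y) - f2 (x, 0)) <= 2).
    { eapply Rle_trans; [apply Cmod_le_Rabs|].
      change (Rabs (fst (f2 (x, y)) - fst (f2 (x, 0))) + Rabs (snd (f2 (x, y)) - snd (f2 (x, 0))) <= 2).
      lra. }
    lra. }
  assert (FT : forall x y y', 0 <= x <= b -> y <= y' -> - Rmin d1 d2 < y -> y' < Rmin d1 d2 ->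
     Cmod (f1 (x, y') - f1 (x, y)) <= (y' - y) * (M + 2)).
  { intros x y y' Hx Hyy Hy Hy'.
    apply (Cmod_CInt_le_const (fun t => Ci * f2 (x, t))%C (M + 2) y y' _ Hyy).
    - intros t Ht. rewrite Cmod_mult, Cmod_Ci, Rmult_1_l. apply HB; [exact Hx|].
      apply Rabs_def1; lra.
    - apply (cder_is_CInt (fun t => f1 (x, t)) (fun t => Ci * f2 (x, t))%C y y' Hyy).
      + intros t Ht. apply (cdiff_vertical f1 x t (f2 (x, t))).
        exact (holo_cdiff f1 f2 (x, t) (proj2 (Hf (x, t) (proj1 Hx)))).
      + intros t Ht. apply (cont2_vertical (fun z => Ci * f2 z)%C).
        apply cont2_mult; [apply cont2_const | apply Hc; lra]. }
  exists (M + 2), (Rmin d1 d2). split; [apply Rmin_pos; apply cond_pos|].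
  intros x e Hx He. split.
  - eapply Rle_trans; [apply FT; lra | right; ring].
  - replace (f1 (x, (- e)%R) - f1 (x, 0))%C with (- (f1 (x, 0) - f1 (x, (- e)%R)))%C by ring.
    rewrite Cmod_opp. eapply Rle_trans; [apply FT; lra | right; ring].
Qed.

Lemma cont2_conj g z : cont2 g z -> cont2 (fun z => Cconj (g z)) z.
Proof. intros [H1 H2]. split; [exact H1 | now apply continuity_2d_pt_opp]. Qed.

Lemma cont2_reflect g z : cont2 g (Cconj z) -> cont2 (fun z => g (Cconj z)) z.
Proof.
  destruct z as [x y]. intros [H1 H2]. split; intros eps.
  - exact (locally_2d_reflect _ _ _ (H1 eps)).
  - exact (locally_2d_reflect _ _ _ (H2 eps)).
Qed.

Lemma Cminus_conj_snd (w : C) : (w - Cconj w = RtoC 2 * Ci * RtoC (snd w))%C.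
Proof. destruct w; apply injective_projections; simpl; ring. Qed.

(** The value that the [N]-th contour predicts for [1 / (2 pi)] times the integral
over the imaginary axis. *)
Definition partial_value p (f : C -> C) (mu : nat -> R) (N : nat) : C :=
  (RtoC (1 / 2) * f (RtoC 0) + sum_upto (fun n => f (RtoC (mu n))) N - weighted_integral p f 0 (INR N))%C.

(** The corner terms tend to [2 i f(N)] times the value of the sawtooth at [N], and
cancel the end-point term of the last piece. *)
Lemma bottom_limit p mu f f1 f2 N :
  0 < p -> mu 0%nat = 0 ->
  (forall n, (1 <= n)%nat ->
     INR n - 1 / 2 < mu n < INR n /\ tan (PI * mu n) = - mu n / p) ->
  analytic_tower f f1 f2 -> (1 <= N)%nat -> p <= INR N ->
  lim0 (bottom p f f1 N) (Ci * RtoC (2 * PI) * partial_value p f mu N)%C.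
Proof.
  intros Hp Hmu0 Hmu Hf HN HpN.
  assert (HN0 : 0 <= INR N) by lra.
  set (gap := fun e x => ((f1 (x, e) - f1 (x, 0)) * log_kernel p (x, e)
     - (f1 (x, (- e)%R) - f1 (x, 0)) * Cconj (log_kernel p (x, e)))%C).
  set (err := fun e => CInt (gap e) 0 (INR N)).
  set (corner := fun z => (f z * log_kernel p z - f (Cconj z) * Cconj (log_kernel p z))%C).
  assert (Herrc : forall e x, 0 < e -> 0 <= x -> @continuous R_UniformSpace C_R_NormedModule (gap e) x).
  { intros e x He Hx.
    assert (HL : cont2 (log_kernel p) (x, e)) by (apply (holo_log_kernel_upper p Hp (x, e) He)).
    assert (H1 : forall y, cont2 f1 (x, y)) by (intros y; apply (Hf (x, y) Hx)).
    apply (cont2_horizontal (fun z => (f1 z - f1 (RtoC (fst z))) * log_kernel p z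
      - (f1 (Cconj z) - f1 (RtoC (fst z))) * Cconj (log_kernel p z))%C x e).
    assert (H2 : cont2 (fun z => f1 (RtoC (fst z))) (x, e)).
    { destruct (H1 0) as [K1 K2]. split; intros eps; cbn [fst snd].
      - destruct (K1 eps) as [d Hd]. exists d. intros u v Hu Hv. apply Hd; [exact Hu|].
        simpl. rewrite Rminus_diag, Rabs_R0. apply cond_pos.
      - destruct (K2 eps) as [d Hd]. exists d. intros u v Hu Hv. apply Hd; [exact Hu|].
        simpl. rewrite Rminus_diag, Rabs_R0. apply cond_pos. }
    apply cont2_minus; apply cont2_mult; try exact HL; try now apply cont2_conj.
    - apply cont2_minus; [apply H1 | exact H2].
    - apply cont2_minus; [apply cont2_reflect, H1 | exact H2]. }
  assert (Hsplit : forall e, 0 < e ->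
     (RtoC 2 * Ci * slice p f1 0 (INR N) e + err e - corner (INR N, e) = bottom p f f1 N e)%C).
  { intros e He. unfold bottom, corner.
    change (Cconj (INR N, e)) with ((INR N, (- e)%R) : C).
    f_equal. symmetry. refine (is_RInt_unique (V := C_R_CompleteNormedModule) _ _ _ _ _).
    assert (I1 := is_CInt_mult (RtoC 2 * Ci) _ _ _ _
       (is_CInt_slice p f f1 f2 0 (INR N) e Hp Hf (Rle_refl 0) HN0 He)).
    assert (I2 : is_CInt (gap e) 0 (INR N) (err e)).
    { apply ex_CInt_cont; [exact HN0|]. intros x Hx. apply Herrc; [exact He | apply Hx]. }
    refine (is_CInt_ext _ _ _ _ _ HN0 _ (is_CInt_plus _ _ _ _ _ _ I1 I2)).
    intros x Hx. unfold gap. cbv beta.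
    replace (RtoC 2 * Ci * (f1 (RtoC x) * RtoC (snd (log_kernel p (x, e)))))%C
      with (f1 (RtoC x) * (RtoC 2 * Ci * RtoC (snd (log_kernel p (x, e)))))%C by ring.
    rewrite <- Cminus_conj_snd. unfold RtoC at 1. ring. }
  apply (lim0_ext (fun e => RtoC 2 * Ci * slice p f1 0 (INR N) e + err e - corner (INR N, e))%C _ _ 1 Rlt_0_1).
  { intros e He. apply Hsplit. lra. }
  assert (Hpi : - (PI / 2) < branch p N (INR N) < PI / 2).
  { unfold branch. pose proof (atan_bound (INR N / p)). pose proof PI_RGT_0.
    assert (0 < atan (INR N / p)).
    { rewrite <- atan_0. apply atan_increasing. apply Rdiv_lt_0_compat; lra. }
    lra. }
  destruct (snd_log_kernel_real p N (INR N) Hp Hpi) as [HG Hs].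
  assert (Lc : lim0 (fun e => corner (INR N, e)) (RtoC 2 * Ci * (f (RtoC (INR N)) * RtoC (branch p N (INR N))))%C).
  { replace (RtoC 2 * Ci * (f (RtoC (INR N)) * RtoC (branch p N (INR N))))%C
      with (corner (INR N, 0)).
    - apply lim0_cont2.
      assert (HL : cont2 (log_kernel p) (INR N, 0)).
      { apply (holo_log_kernel p (INR N, 0)); [simpl; lra | exact HG]. }
      apply cont2_minus; apply cont2_mult; try exact HL; try now apply cont2_conj.
      + apply (Hf (INR N, 0) HN0).
      + apply cont2_reflect. apply (Hf (Cconj (INR N, 0)) HN0).
    - unfold corner. rewrite <- Hs.
      replace (Cconj (INR N, 0)) with ((INR N, 0) : C)
        by (apply injective_projections; simpl; ring).
      transitivity (f (INR N, 0) * (log_kernel p (INR N, 0) - Cconj (log_kernel p (INR N, 0))))%C; [ring|].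
      rewrite Cminus_conj_snd. change (f (INR N, 0)) with (f (RtoC (INR N))). ring. }
  assert (Le : lim0 err 0%C).
  { destruct (analytic_tower_lipschitz f f1 f2 (INR N) Hf HN0) as (M & d & Hd & HM).
    apply (lim0_small err (INR N * (2 * M)) (Rmin d (1 / 2))); [apply Rmin_pos; lra|].
    intros e He. pose proof (Rmin_l d (1 / 2)). pose proof (Rmin_r d (1 / 2)).
    eapply Rle_trans.
    - eapply (Cmod_CInt_le_const (gap e) (2 * M * (e * (4 + 2 / sqrt e))) 0 (INR N) _ HN0).
      2: { apply ex_CInt_cont; [exact HN0|]. intros x Hx. apply Herrc; lra. }
      intros x Hx. destruct (HM x e Hx ltac:(lra)) as [M1 M2].
      pose proof (Cmod_log_kernel_le p x e Hp ltac:(lra)) as HL.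
      unfold gap. unfold Cminus at 1. eapply Rle_trans; [apply Cmod_triangle|].
      rewrite Cmod_opp, !Cmod_mult, Cmod_conj.
      set (l := Cmod (log_kernel p (x, e))) in *.
      assert (0 <= l) by apply Cmod_ge_0.
      pose proof (Cmod_ge_0 (f1 (x, e) - f1 (x, 0))).
      apply Rle_trans with (M * e * (4 + 2 / sqrt e) + M * e * (4 + 2 / sqrt e)).
      + apply Rplus_le_compat; apply Rmult_le_compat; try assumption; apply Cmod_ge_0.
      + right; ring.
    - right. ring. }
  assert (Ls := lim0_mult (RtoC 2 * Ci) _ _
    (slice_limit_integer p mu Hp Hmu0 Hmu f f1 f2 Hf N HN)).
  assert (K := lim0_minus _ _ _ _ (lim0_plus _ _ _ _ Ls Le) Lc).
  unfold partial_value.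
  replace (Ci * RtoC (2 * PI) * _)%C with
    (RtoC 2 * Ci *
       (RtoC (PI / 2) * f (RtoC 0) + RtoC PI * sum_upto (fun n : nat => f (RtoC (mu n))) N +
        f (RtoC (INR N)) * RtoC (branch p N (INR N)) -
        RtoC PI * weighted_integral p f 0 (INR N)) + 0 -
      RtoC 2 * Ci * (f (RtoC (INR N)) * RtoC (branch p N (INR N))))%C; [exact K|].
  replace (RtoC (PI / 2)) with (RtoC PI * RtoC (1 / 2))%C
    by (rewrite <- RtoC_mult; f_equal; field).
  rewrite RtoC_mult. ring.
Qed.

(** * Improper integrals *)

Lemma locally_Cmod (l : C) (P : C -> Prop) :
  @locally C_R_NormedModule l P ->
  exists eps, 0 < eps /\ forall w, Cmod (w - l) < eps -> P w.
Proof.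
  intros [eps H]. exists eps. split; [apply cond_pos|].
  intros w Hw. apply H. split.
  - change (Rabs (fst (w - l)%C) < eps).
    eapply Rle_lt_trans; [apply Rabs_fst_le_Cmod | exact Hw].
  - change (Rabs (snd (w - l)%C) < eps).
    eapply Rle_lt_trans; [apply Rabs_snd_le_Cmod | exact Hw].
Qed.

Lemma Cmod_ball (l w : C) (eps : R) : 
  @ball C_R_NormedModule l (eps / 2) w -> Cmod (w - l) < eps.
Proof.
  intros [H1 H2]. change (Rabs (fst w - fst l) < eps / 2) in H1.
  change (Rabs (snd w - snd l) < eps / 2) in H2.
  eapply Rle_lt_trans; [apply Cmod_le_Rabs|].
  change (Rabs (fst w - fst l) + Rabs (snd w - snd l) < eps). lra.
Qed.

(** Completeness in terms of [Cmod], for an arbitrary filter; it is used both for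
[b] tending to infinity and for the pair [(e, Y)]. *)
Lemma C_cauchy_limit {T : Type} (F : (T -> Prop) -> Prop) {FF : ProperFilter F} (f : T -> C) :
  (forall eps, 0 < eps -> exists P, F P /\
     forall u v, P u -> P v -> Cmod (f u - f v) < eps) ->
  exists l : C, forall eps, 0 < eps -> F (fun u => Cmod (f u - l) < eps).
Proof.
  intros H.
  destruct (proj1 (filterlim_locally_cauchy (U := C_R_CompleteNormedModule) (F := F) f)) as [l Hl].
  { intros eps. destruct (H eps (cond_pos eps)) as (P & HP & K). exists P. split; [exact HP|].
    intros u v Hu Hv. split.
    - change (Rabs (fst (f v - f u)%C) < eps).
      eapply Rle_lt_trans; [apply Rabs_fst_le_Cmod | now apply K].
    - change (Rabs (snd (f v - f u)%C) < eps).
      eapply Rle_lt_trans; [apply Rabs_snd_le_Cmod | now apply K]. }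
  exists l. intros eps Heps. assert (Hh : 0 < eps / 2) by lra.
  assert (K := proj1 (filterlim_locally f l) Hl (mkposreal _ Hh)).
  refine (filter_imp _ _ _ K). intros u Hu. now apply Cmod_ball.
Qed.

Lemma is_CInt_gen_intro (f : R -> C) (Fa Fb : (R -> Prop) -> Prop)
  {FFa : Filter Fa} {FFb : Filter Fb} (I : R -> R -> C) (l : C) :
  filter_prod Fa Fb (fun ab => is_CInt f (fst ab) (snd ab) (I (fst ab) (snd ab))) ->
  (forall eps, 0 < eps -> filter_prod Fa Fb (fun ab => Cmod (I (fst ab) (snd ab) - l) < eps)) ->
  @is_RInt_gen C_R_NormedModule f Fa Fb l.
Proof.
  intros H1 H2 P HP. destruct (locally_Cmod l P HP) as (eps & Heps & HPe).
  refine (filter_imp _ _ _ (filter_and _ _ H1 (H2 eps Heps))).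
  intros ab [K1 K2]. exists (I (fst ab) (snd ab)). split; [exact K1 | now apply HPe].
Qed.

Lemma RInt_le_RInt_gen (g : R -> R) I a b m :
  (forall y, continuous g y) -> (forall y, 0 <= g y) ->
  is_RInt_gen g (Rbar_locally m_infty) (Rbar_locally p_infty) I ->
  a <= b -> is_RInt g a b m -> m <= I.
Proof.
  intros Hc H0 HI Hab Hm. apply le_epsilon. intros eps Heps.
  destruct (HI (fun v => Rabs (v - I) < eps)) as [Q S [A HA] [B HB] K].
  { exists (mkposreal _ Heps). intros v Hv. exact Hv. }
  set (a' := Rmin (A - 1) a). set (b' := Rmax (B + 1) b).
  assert (Ha' : a' <= a) by apply Rmin_r. assert (Hb' : b <= b') by apply Rmax_r.
  assert (Ha'' : a' < A) by (pose proof (Rmin_l (A - 1) a); unfold a'; lra).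
  assert (Hb'' : B < b') by (pose proof (Rmax_l (B + 1) b); unfold b'; lra).
  destruct (K a' b' (HA _ Ha'') (HB _ Hb'')) as (v & Hv & Hvi). cbn [fst snd] in Hv.
  assert (Hex : forall c d, ex_RInt g c d).
  { intros c d. apply (ex_RInt_continuous (V := R_CompleteNormedModule)). intros; apply Hc. }
  destruct (Hex a' a) as [m1 Hm1]. destruct (Hex b b') as [m2 Hm2].
  assert (E := is_RInt_Chasles _ _ _ _ _ _ (is_RInt_Chasles _ _ _ _ _ _ Hm1 Hm) Hm2).
  assert (P1 : 0 <= m1).
  { apply (is_RInt_ge_0 g a' a); [lra | exact Hm1 | intros; apply H0]. }
  assert (P2 : 0 <= m2).
  { apply (is_RInt_ge_0 g b b'); [lra | exact Hm2 | intros; apply H0]. }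
  assert (Ev : v = m1 + m + m2).
  { apply (is_RInt_unique (V := R_CompleteNormedModule)) in E, Hv. rewrite <- Hv. exact E. }
  apply Rabs_def2 in Hvi. destruct Hvi. lra.
Qed.

Lemma weight_bounds p x : 0 < p -> 0 <= weight p x <= 1 + / (PI * p).
Proof.
  intros Hp. pose proof PI_RGT_0 as Hpi.
  assert (Hq : 0 < p ^ 2 + x ^ 2) by nra.
  assert (Hi : 0 < / (PI * p)) by (apply Rinv_0_lt_compat; nra).
  assert (E : weight p x = 1 + / (PI * p) * (p ^ 2 / (p ^ 2 + x ^ 2))).
  { unfold weight. field. repeat split; nra. }
  assert (H : 0 <= p ^ 2 / (p ^ 2 + x ^ 2) <= 1).
  { split; [apply Rdiv_le_0_compat; nra|].
    apply (Rmult_le_reg_r (p ^ 2 + x ^ 2)); [exact Hq|].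
    unfold Rdiv. rewrite Rmult_assoc, Rinv_l, Rmult_1_l, Rmult_1_r by lra. nra. }
  rewrite E. nra.
Qed.

Lemma continuous_Cmod (g : R -> C) t :
  @continuous R_UniformSpace C_R_NormedModule g t -> continuous (fun t => Cmod (g t)) t.
Proof.
  intros H. apply (continuous_ext (fun t => @norm R_AbsRing C_R_NormedModule (g t))).
  { intros s. apply norm_C. }
  exact (filterlim_comp _ _ _ g _ _ _ _ H (@filterlim_norm R_AbsRing C_R_NormedModule (g t))).
Qed.

Lemma weighted_integral_converges p f f1 f2 :
  0 < p -> analytic_tower f f1 f2 ->
  ex_RInt_gen (fun x => Cmod (f (x, 0))) (at_point 0) (Rbar_locally p_infty) ->
  exists I1 : C, forall eps, 0 < eps ->
    exists B, forall b, B < b -> Cmod (weighted_integral p f 0 b - I1) < eps.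
Proof.
  intros Hp Hf [I HI].
  set (W := 1 + / (PI * p)).
  assert (HW : 0 < W).
  { unfold W. assert (0 < / (PI * p)); [|lra]. apply Rinv_0_lt_compat. pose proof PI_RGT_0; nra. }
  assert (Hc : forall x, 0 <= x -> continuous (fun x => Cmod (f (x, 0))) x).
  { intros x Hx. apply continuous_Cmod.
    exact (proj1 (analytic_tower_continuous_real f f1 f2 x Hf Hx)). }
  destruct (C_cauchy_limit (Rbar_locally p_infty) (fun b => weighted_integral p f 0 b)) as [l Hl].
  2: { exists l. exact Hl. }
  intros eps Heps.
  assert (He' : 0 < eps / (2 * W)) by (apply Rdiv_lt_0_compat; lra).
  destruct (HI (fun v => Rabs (v - I) < eps / (2 * W))) as [Q S HQ [B HB] K].
  { exists (mkposreal _ He'). intros v Hv. exact Hv. }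
  exists (fun b => Rmax B 0 < b). split; [exists (Rmax B 0); auto|].
  assert (main : forall u v, Rmax B 0 < u -> u <= v ->
    Cmod (weighted_integral p f 0 v - weighted_integral p f 0 u) < eps).
  { intros u v Hu Huv. pose proof (Rmax_l B 0). pose proof (Rmax_r B 0).
    destruct (K 0 u HQ (HB u ltac:(lra))) as (iu & Hiu & Ku).
    destruct (K 0 v HQ (HB v ltac:(lra))) as (iv & Hiv & Kv). cbn [fst snd] in Hiu, Hiv.
    assert (Hex : ex_RInt (fun x => Cmod (f (x, 0))) u v).
    { apply (ex_RInt_continuous (V := R_CompleteNormedModule)).
      rewrite Rmin_left, Rmax_right by lra. intros x Hx. apply Hc. lra. }
    destruct Hex as [j Hj].
    assert (Ej : iv = iu + j).
    { assert (E := is_RInt_Chasles _ _ _ _ _ _ Hiu Hj).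
      apply (is_RInt_unique (V := R_CompleteNormedModule)) in E, Hiv.
      rewrite <- Hiv. exact E. }
    rewrite (weighted_integral_Chasles p Hp f f1 f2 Hf 0 u v) by lra.
    replace (weighted_integral p f 0 u + weighted_integral p f u v
      - weighted_integral p f 0 u)%C with (weighted_integral p f u v) by ring.
    apply Rle_lt_trans with (W * j).
    - apply (Cmod_CInt_le (fun x => RtoC (weight p x) * f (RtoC x))%C
        (fun x => W * Cmod (f (x, 0))) u v _ _ Huv).
      + intros x Hx. rewrite Cmod_mult, Cmod_R.
        destruct (weight_bounds p x Hp) as [W1 W2]. rewrite Rabs_pos_eq by exact W1.
        apply Rmult_le_compat_r; [apply Cmod_ge_0 | exact W2].
      + apply (is_CInt_weighted p f f1 f2); try assumption; lra.
      + exact (is_RInt_scal (V := R_NormedModule) _ u v W j Hj).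
    - apply Rabs_def2 in Ku, Kv. destruct Ku, Kv.
      apply Rlt_le_trans with (W * (2 * (eps / (2 * W)))).
      + apply Rmult_lt_compat_l; lra.
      + right. field. lra. }
  intros u v Hu Hv. destruct (Rle_dec u v) as [h|h].
  - replace (weighted_integral p f 0 u - weighted_integral p f 0 v)%C
      with (- (weighted_integral p f 0 v - weighted_integral p f 0 u))%C by ring.
    rewrite Cmod_opp. now apply main.
  - apply main; lra.
Qed.

Definition edge (f : C -> C) (r y : R) : R := exp (- (2 * PI * Rabs y)) * Cmod (f (r, y)).

Lemma continuous_edge f f1 f2 r y : analytic_tower f f1 f2 -> 0 <= r -> continuous (edge f r) y.
Proof.
  intros Hf Hr. apply (continuous_mult (K := R_AbsRing)).
  - apply (continuous_comp (fun y => - (2 * PI * Rabs y)) exp).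
    + apply (continuous_opp (V := R_NormedModule) (fun y => 2 * PI * Rabs y)).
      apply (continuous_mult (K := R_AbsRing) (fun _ => 2 * PI)); [apply continuous_const|].
      apply continuous_Rabs.
    + apply continuous_exp.
  - apply continuous_Cmod. apply cont2_vertical. apply (Hf (r, y) Hr).
Qed.

Lemma edge_integrals f f1 f2 r e Y I :
  analytic_tower f f1 f2 -> 0 <= r -> 0 < e -> e <= Y ->
  is_RInt_gen (edge f r) (Rbar_locally m_infty) (Rbar_locally p_infty) I ->
  exists m m', m <= I /\ m' <= I /\
    is_RInt (fun y => exp (- (2 * PI * y)) * Cmod (f (r, y))) e Y m /\
    is_RInt (fun y => exp (- (2 * PI * y)) * Cmod (f (r, - y))) e Y m'.
Proof.
  intros Hf Hr He HeY HI.
  assert (Hc := fun y => continuous_edge f f1 f2 r y Hf Hr).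
  assert (H0 : forall y, 0 <= edge f r y).
  { intros y. apply Rmult_le_pos; [left; apply exp_pos | apply Cmod_ge_0]. }
  assert (Hex : forall c d, ex_RInt (edge f r) c d).
  { intros c d. apply (ex_RInt_continuous (V := R_CompleteNormedModule)). intros; apply Hc. }
  destruct (Hex e Y) as [m Hm]. destruct (Hex (- Y) (- e)) as [m' Hm'].
  exists m, m'. split; [|split; [|split]].
  - exact (RInt_le_RInt_gen _ I e Y m Hc H0 HI HeY Hm).
  - refine (RInt_le_RInt_gen _ I (- Y) (- e) m' Hc H0 HI _ Hm'). lra.
  - refine (is_RInt_ext _ _ _ _ _ _ Hm). rewrite Rmin_left, Rmax_right by lra.
    intros y Hy. unfold edge. rewrite Rabs_pos_eq by lra. reflexivity.
  - assert (K := is_RInt_swap _ _ _ _ (is_RInt_comp_opp (edge f r) Y e m' Hm')).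
    assert (K' := is_RInt_opp (V := R_NormedModule) _ _ _ _ K).
    refine (is_RInt_ext _ _ _ _ _ _ (eq_ind _ (fun v => is_RInt _ e Y v) K' m' _)).
    + rewrite Rmin_left, Rmax_right by lra. intros y Hy.
      unfold edge. change (- - (exp (- (2 * PI * Rabs (- y))) * Cmod (f (r, - y))) =
        exp (- (2 * PI * y)) * Cmod (f (r, - y))).
      rewrite Ropp_involutive, Rabs_Ropp, Rabs_pos_eq by lra. reflexivity.
    + apply Ropp_involutive.
Qed.

Lemma sum_n_sum_upto (u : nat -> C) n :
  @sum_n C_AbelianMonoid (fun k => u (S k)) n = sum_upto u (S n).
Proof.
  induction n as [|n IH].
  - rewrite sum_O. simpl. symmetry. apply Cplus_0_l.
  - rewrite sum_Sn, IH. reflexivity.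
Qed.

(** * The summation formula *)

Lemma filter_prod_right_infty (P : R * R -> Prop) (d Y0 : R) :
  0 < d -> (forall e Y, 0 < e < d -> Y0 < Y -> P (e, Y)) ->
  filter_prod (at_right 0) (Rbar_locally p_infty) P.
Proof.
  intros Hd H.
  apply (Filter_prod _ _ _ (fun e => 0 < e < d) (fun Y => Y0 < Y)).
  - exists (mkposreal _ Hd). intros e He He0. split; [exact He0|].
    change (Rabs (e - 0) < d) in He. rewrite Rminus_0_r in He.
    now apply Rabs_def2 in He.
  - exists Y0. auto.
  - intros e Y He HY. now apply H.
Qed.

(** The edge term of [contour_bound] is small for large [N]; with [N] fixed, the top
term is small for large [Y], and the bottom side is near its limit for small [e]. *)
Lemma side_approximates p mu f f1 f2 :
  0 < p -> mu 0%nat = 0 ->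
  (forall n, (1 <= n)%nat ->
     INR n - 1 / 2 < mu n < INR n /\ tan (PI * mu n) = - mu n / p) ->
  analytic_tower f f1 f2 ->
  (forall b, 0 <= b -> forall eps, 0 < eps -> exists Y0, forall x y,
     0 <= x <= b -> Y0 < y ->
     Cmod (f (x, y)) * exp (- (2 * PI * y)) < eps /\
     Cmod (f (x, - y)) * exp (- (2 * PI * y)) < eps) ->
  (forall eps, 0 < eps -> exists r0, forall r, r0 < r -> exists I, I <= eps /\
     is_RInt_gen (edge f r) (Rbar_locally m_infty) (Rbar_locally p_infty) I) ->
  forall eta, 0 < eta -> exists N0, forall N, (N0 <= N)%nat ->
  exists d Y0, 0 < d /\ forall e Y, 0 < e < d -> Y0 < Y ->
    e <= Y /\ Cmod (side p f1 e Y - RtoC (2 * PI) * partial_value p f mu N) < eta.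
Proof.
  intros Hp Hmu0 Hmu Hf Htop Hedge eta Heta.
  set (C0 := 2 * PI + 2 / p).
  assert (HC0 : 0 < C0).
  { unfold C0. pose proof PI_RGT_0. assert (0 < 2 / p) by (apply Rdiv_lt_0_compat; lra). lra. }
  destruct (Hedge (eta / (8 * C0))) as [r0 Hr0]; [apply Rdiv_lt_0_compat; lra|].
  destruct (INR_unbounded (Rmax r0 (Rmax p 1))) as [N0 HN0].
  exists N0. intros N HN. apply le_INR in HN.
  pose proof (Rmax_l r0 (Rmax p 1)). pose proof (Rmax_r r0 (Rmax p 1)).
  pose proof (Rmax_l p 1). pose proof (Rmax_r p 1).
  assert (HN1 : (1 <= N)%nat) by (apply INR_le; simpl; lra).
  assert (HNp : p <= INR N) by lra.
  destruct (Hr0 (INR N) ltac:(lra)) as (I & HI & HIg).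
  set (K := 2 * (2 * C0 * INR N + 6)).
  assert (HK : 0 < K) by (unfold K; nra).
  destruct (Htop (INR N) ltac:(lra) (eta / (4 * K))) as [Y0 HY0]; [apply Rdiv_lt_0_compat; lra|].
  destruct (bottom_limit p mu f f1 f2 N Hp Hmu0 Hmu Hf HN1 HNp (eta / 4) ltac:(lra)) as (d & Hd & Hb).
  exists (Rmin d 1), (Rmax Y0 1). split; [apply Rmin_pos; lra|]. intros e Y He HY.
  pose proof (Rmin_l d 1). pose proof (Rmin_r d 1). pose proof (Rmax_l Y0 1). pose proof (Rmax_r Y0 1).
  split; [lra|].
  specialize (Hb e ltac:(lra)).
  destruct (edge_integrals f f1 f2 (INR N) e Y I Hf ltac:(lra) ltac:(lra) ltac:(lra) HIg)
    as (m & m' & Hm & Hm' & Im & Im').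
  assert (HB := contour_bound p f f1 f2 N e Y (eta / (4 * K)) m m' Hp HNp ltac:(lra) ltac:(lra) ltac:(lra) Hf
    ltac:(intros x Hx; destruct (HY0 x Y Hx ltac:(lra)); lra) Im Im').
  fold C0 in HB. fold K in HB.
  set (v := (RtoC (2 * PI) * partial_value p f mu N)%C) in *.
  replace (Ci * RtoC (2 * PI) * partial_value p f mu N)%C with (Ci * v)%C in Hb by (unfold v; ring).
  replace (Cmod (side p f1 e Y - v)) with (Cmod (Ci * (side p f1 e Y - v)))
    by (rewrite Cmod_mult, Cmod_Ci; ring).
  replace (Ci * (side p f1 e Y - v))%C
    with (- (bottom p f f1 N e - Ci * side p f1 e Y) + (bottom p f f1 N e - Ci * v))%C by ring.
  eapply Rle_lt_trans; [apply Cmod_triangle|]. rewrite Cmod_opp.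
  assert (A1 : C0 * (m + m') <= eta / 4).
  { apply Rle_trans with (C0 * (2 * (eta / (8 * C0)))).
    - apply Rmult_le_compat_l; lra.
    - right. field. lra. }
  assert (A2 : K * (eta / (4 * K)) = eta / 4) by (field; lra).
  lra.
Qed.

Theorem theorem3p3 :
  forall (p : R) (lambda : nat -> R) (f : C -> C),
  0 < p ->
  (forall n : nat, (1 <= n)%nat ->
     INR n - 1 / 2 < lambda n < INR n /\
     tan (PI * lambda n) = - lambda n / p) ->
  analytic_on_right_half_plane f ->
  (forall y : R,
     ex_RInt_gen (fun x : R => Cmod (f (x, y)))
       (at_point 0) (Rbar_locally p_infty)) ->
  (exists M Y : R, forall y : R, Y <= Rabs y ->
     RInt_gen (fun x : R => Cmod (f (x, y)))
       (at_point 0) (Rbar_locally p_infty) <= M) ->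
  (forall a b : R, 0 <= a -> a <= b ->
     forall eps : posreal, exists Y : R, forall x y : R,
       a <= x <= b -> Y < y ->
       Cmod (f (x, y)) * exp (- (2 * PI * y)) < eps /\
       Cmod (f (x, - y)) * exp (- (2 * PI * y)) < eps) ->
  (* finiteness for all large [r] is implicit in the limit being [0]; it has to
     be explicit because [RInt_gen] is total *)
  Rbar_locally p_infty (fun r : R =>
     ex_RInt_gen (fun y : R => exp (- (2 * PI * Rabs y)) * Cmod (f (r, y)))
       (Rbar_locally m_infty) (Rbar_locally p_infty)) ->
  is_lim (fun r : R =>
     RInt_gen (fun y : R => exp (- (2 * PI * Rabs y)) * Cmod (f (r, y)))
       (Rbar_locally m_infty) (Rbar_locally p_infty)) p_infty 0 ->
  @ex_series C_AbsRing C_NormedModule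
     (fun k : nat => f (RtoC (lambda (S k)))) ->
  (* the second integrand is singular at [0], hence [at_right 0] *)
  exists I1 I2 : C,
    @is_RInt_gen C_R_NormedModule
      (fun x : R =>
         (RtoC ((p * (p + 1 / PI) + x ^ 2) / (p ^ 2 + x ^ 2)) * f (RtoC x))%C)
      (at_point 0) (Rbar_locally p_infty) I1 /\
    @is_RInt_gen C_R_NormedModule
      (fun t : R =>
         ((C_derive f (Ci * RtoC t) + C_derive f (- (Ci * RtoC t))) *
          RtoC (ln (1 / (1 - sigma_ratio p (- t) * exp (- (2 * PI * t))))))%C)
      (at_right 0) (Rbar_locally p_infty) I2 /\
    @is_series C_AbsRing C_NormedModule
      (fun k : nat => f (RtoC (lambda (S k))))
      (- RtoC (1 / 2) * f (RtoC 0) + I1 - RtoC (1 / (2 * PI)) * I2)%C.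
Proof.
  intros p lambda f Hp Hlam Han Hint _ Htop Hex Hlim _.
  set (f1 := C_derive f).
  assert (Hf : analytic_tower f f1 (C_derive f1)).
  { intros z Hz. pose proof (Han z Hz) as H. split.
    - now apply analytic_at_holo.
    - apply analytic_at_holo. now apply analytic_at_deriv. }
  (* The zero [mu 0 = 0] starts the sawtooth. *)
  set (mu := fun n => match n with O => 0 | S _ => lambda n end).
  assert (Hmu : forall n, (1 <= n)%nat ->
     INR n - 1 / 2 < mu n < INR n /\ tan (PI * mu n) = - mu n / p).
  { intros [|n] Hn; [lia|]. now apply Hlam. }
  assert (Htop' : forall b, 0 <= b -> forall eps, 0 < eps -> exists Y0, forall x y,
     0 <= x <= b -> Y0 < y ->
     Cmod (f (x, y)) * exp (- (2 * PI * y)) < eps /\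
     Cmod (f (x, - y)) * exp (- (2 * PI * y)) < eps).
  { intros b Hb eps Heps. exact (Htop 0 b (Rle_refl 0) Hb (mkposreal _ Heps)). }
  assert (Hedge : forall eps, 0 < eps -> exists r0, forall r, r0 < r -> exists I, I <= eps /\
     is_RInt_gen (edge f r) (Rbar_locally m_infty) (Rbar_locally p_infty) I).
  { intros eps Heps. apply is_lim_spec in Hlim.
    destruct (filter_and _ _ Hex (Hlim (mkposreal _ Heps))) as [r0 Hr0].
    exists r0. intros r Hr. destruct (Hr0 r Hr) as [K1 K2].
    exists (RInt_gen (edge f r) (Rbar_locally m_infty) (Rbar_locally p_infty)). split.
    - simpl in K2. rewrite Rminus_0_r in K2. apply Rabs_def2 in K2. left. apply K2.
    - exact (RInt_gen_correct (V := R_CompleteNormedModule) _ K1). }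
  assert (Main := side_approximates p mu f f1 _ Hp eq_refl Hmu Hf Htop' Hedge).
  (* Two values with small [e] and large [Y] are close to the same predicted value,
     so the double limit exists without a separate estimate of the singularity at [0]. *)
  destruct (C_cauchy_limit (filter_prod (at_right 0) (Rbar_locally p_infty))
     (fun eY => side p f1 (fst eY) (snd eY))) as [J HJ].
  { intros eps Heps. destruct (Main (eps / 2) ltac:(lra)) as [N HN].
    destruct (HN N (le_n N)) as (d & Y0 & Hd & K).
    exists (fun eY => 0 < fst eY < d /\ Y0 < snd eY). split.
    - apply (filter_prod_right_infty _ d Y0 Hd). auto.
    - intros [e Y] [e' Y'] [He HY] [He' HY']. cbn [fst snd] in *.
      destruct (K e Y He HY) as [_ K1]. destruct (K e' Y' He' HY') as [_ K2].
      set (v := (RtoC (2 * PI) * partial_value p f mu N)%C) in *.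
      replace (side p f1 e Y - side p f1 e' Y')%C
        with ((side p f1 e Y - v) + - (side p f1 e' Y' - v))%C by ring.
      eapply Rle_lt_trans; [apply Cmod_triangle|]. rewrite Cmod_opp. lra. }
  destruct (weighted_integral_converges p f f1 _ Hp Hf (Hint 0)) as [I1 HI1].
  (* The integrand of the statement has [ln (1 / (1 - g))], hence the sign. *)
  exists I1, (- J)%C. split; [|split].
  - apply (is_CInt_gen_intro _ _ _ (fun a b => weighted_integral p f a b)).
    + apply (Filter_prod _ _ _ (fun a => a = 0) (fun b => 0 < b)); [reflexivity | exists 0; auto |].
      intros a b -> Hb. apply (is_CInt_weighted p f f1 (C_derive f1)); try assumption; simpl; lra.
    + intros eps Heps. destruct (HI1 eps Heps) as [B HB].
      apply (Filter_prod _ _ _ (fun a => a = 0) (fun b => B < b)); [reflexivity | exists B; auto |].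
      intros a b -> Hb. now apply HB.
  - apply (is_CInt_gen_intro _ _ _ (fun e Y => (- side p f1 e Y)%C)).
    + apply (filter_prod_right_infty _ 1 1 Rlt_0_1). intros e Y He HY. cbn [fst snd].
      assert (K := is_CInt_mult (- (1)) _ _ _ _ (is_CInt_side p f f1 _ e Y Hp Hf (proj1 He) ltac:(lra))).
      replace (- (1) * side p f1 e Y)%C with (- side p f1 e Y)%C in K by ring.
      refine (is_CInt_ext _ _ e Y _ ltac:(lra) _ K).
      intros t Ht. cbv beta. fold f1.
      assert (Ht0 : 0 < t) by lra.
      rewrite log_kernel_vertical by lra.
      replace (Ci * RtoC t)%C with ((0, t) : C) by (apply injective_projections; simpl; ring).
      replace (- (0, t))%C with ((0, (- t)%R) : C) by (apply injective_projections; simpl; ring).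
      assert (Hg : 0 < 1 - sigma_ratio p (- t) * exp (- (2 * PI * t))).
      { assert (Hg := fst_kernel_lt1 p 0 t Hp Ht0). rewrite kernel_vertical in Hg by assumption.
        simpl in Hg. lra. }
      unfold Rdiv at 1. rewrite Rmult_1_l, ln_Rinv by exact Hg.
      rewrite RtoC_opp. ring.
    + intros eps Heps. refine (filter_imp _ _ _ (HJ eps Heps)). intros [e Y] K. cbn [fst snd] in *.
      replace (- side p f1 e Y - - J)%C with (- (side p f1 e Y - J))%C by ring.
      now rewrite Cmod_opp.
  - assert (HK : forall eps, 0 < eps -> exists N0, forall N, (N0 <= N)%nat ->
       Cmod (RtoC (2 * PI) * partial_value p f mu N - J) < eps).
    { intros eps Heps. destruct (Main (eps / 2) ltac:(lra)) as [N0 HN0].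
      exists N0. intros N HN. destruct (HN0 N HN) as (d & Y0 & Hd & K).
      assert (Hh : 0 < eps / 2) by lra.
      destruct (filter_ex _ (filter_and _ _ (HJ (eps / 2) Hh)
        (filter_prod_right_infty (fun eY => 0 < fst eY < d /\ Y0 < snd eY) d Y0 Hd
           (fun e Y He HY => conj He HY)))) as [[e Y] [K1 [K2 K3]]].
      cbn [fst snd] in *. destruct (K e Y K2 K3) as [_ K4].
      set (v := (RtoC (2 * PI) * partial_value p f mu N)%C) in *.
      replace (v - J)%C with ((side p f1 e Y - J) + - (side p f1 e Y - v))%C by ring.
      eapply Rle_lt_trans; [apply Cmod_triangle|]. rewrite Cmod_opp. lra. }
    intros P HP. destruct (locally_Cmod _ P HP) as (eps & Heps & HPe).
    destruct (HK (eps / 2) ltac:(lra)) as [N0 HN0].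
    destruct (HI1 (eps / 2) ltac:(lra)) as [B HB].
    destruct (INR_unbounded B) as [N1 HN1].
    exists (N0 + N1)%nat. intros n Hn. apply HPe.
    assert (HnB : B < INR (S n)).
    { eapply Rlt_le_trans; [exact HN1|]. apply le_INR. lia. }
    specialize (HB _ HnB). specialize (HN0 (S n) ltac:(lia)).
    assert (Es : @sum_n C_AbelianMonoid (fun k => f (RtoC (lambda (S k)))) n
       = sum_upto (fun n => f (RtoC (mu n))) (S n)).
    { exact (sum_n_sum_upto (fun n => f (RtoC (mu n))) n). }
    change (Cmod (@sum_n C_AbelianMonoid (fun k => f (RtoC (lambda (S k)))) n
      - (- RtoC (1 / 2) * f (RtoC 0) + I1 - RtoC (1 / (2 * PI)) * - J))%C < eps).
    rewrite Es. pose proof PI_RGT_0 as Hpi.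
    assert (Epi : (RtoC (1 / (2 * PI)) * RtoC (2 * PI) = 1)%C).
    { rewrite <- RtoC_mult. f_equal. field. lra. }
    set (c := RtoC (1 / (2 * PI))) in *.
    set (z := sum_upto (fun n => f (RtoC (mu n))) (S n)) in *.
    replace (z - (- RtoC (1 / 2) * f (RtoC 0) + I1 - c * - J))%C
      with (c * (RtoC (2 * PI) * partial_value p f mu (S n) - J)
            + (weighted_integral p f 0 (INR (S n)) - I1))%C.
    2: { unfold partial_value. fold z.
         set (k := (RtoC (1 / 2) * f (RtoC 0) + z - weighted_integral p f 0 (INR (S n)))%C).
         transitivity (c * RtoC (2 * PI) * k - c * J + (weighted_integral p f 0 (INR (S n)) - I1))%C;
           [ring|]. rewrite Epi. unfold k. ring. }
    eapply Rle_lt_trans; [apply Cmod_triangle|]. rewrite Cmod_mult.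
    assert (Hc : Cmod c <= 1).
    { unfold c. rewrite Cmod_R, Rabs_pos_eq.
      - apply (Rmult_le_reg_r (2 * PI)); [lra|].
        unfold Rdiv. rewrite Rmult_1_l, Rinv_l by lra. pose proof PI2_3_2. lra.
      - left. apply Rdiv_lt_0_compat; lra. }
    pose proof (Cmod_ge_0 (RtoC (2 * PI) * partial_value p f mu (S n) - J)) as H0.
    pose proof (Cmod_ge_0 c). nra.
Qed.
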